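(* Let $n \geq 2$. A finitely presentable $n$-parameter persistence module is structurally stable if and only if it is indecomposable or zero.
   Context: Fix a field $\mathbb{k}$ and let $\mathbf{vec}$ be the category of finite dimensional $\mathbb{k}$-vector spaces. $\mathbf{R}^n$ is the poset $\mathbb{R}^n$ with the product (componentwise) order, viewed as a category. An $n$-parameter persistence module is a functor $M : \mathbf{R}^n \to \mathbf{vec}$; morphisms are natural transformations. For $i \in \mathbf{R}^n$, let $\mathsf{P}_i : \mathbf{R}^n \to \mathbf{vec}$ be the functor with $\mathsf{P}_i(j) = \mathbb{k}$ if $i \leq j$ and $0$ otherwise, all structure morphisms not forced to be zero being the identity. A module is finitely presentable if it is isomorphic to the cokernel of a morphism $\bigoplus_{j \in J} \mathsf{P}_j \to \bigoplus_{i \in I} \mathsf{P}_i$ with $I, J$ finite multisets of elements of $\mathbf{R}^n$. A module is decomposable if it is isomorphic to $A \oplus B$ with $A, B$ both non-zero; it is indecomposable if it is non-zero and not decomposable. Interleavings: for $r \in \mathbb{R}$ and $s \in \mathbf{R}^n$, $s + r$ denotes $(s_1+r,\dots,s_n+r)$. The shift $M[r]$ is defined by $M[r](s) = M(s+r)$, with the corresponding structure morphisms (and similarly $f[r]$ for morphisms $f$). For $r \geq 0$, $\eta^M_r : M \to M[r]$ is the natural transformation given by the structure morphisms $M(a) \to M(a+r)$. For $\epsilon \geq 0$, an $\epsilon$-interleaving between $M$ and $N$ is a pair of morphisms $f : M \to N[\epsilon]$, $g : N \to M[\epsilon]$ with $g[\epsilon]\circ f = \eta^M_{2\epsilon}$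 and $f[\epsilon] \circ g = \eta^N_{2\epsilon}$. The interleaving distance is $d_I(M,N) = \inf\{\epsilon \geq 0 : M \text{ and } N \text{ are } \epsilon\text{-interleaved}\} \in [0,\infty]$. Matchings: for $\epsilon \geq 0$ and $M, N : \mathbf{R}^n \to \mathbf{vec}$, an $\epsilon$-matching between $M$ and $N$ consists of two decompositions $M \cong \bigoplus_{j \in J} M_j$ and $N \cong \bigoplus_{j \in J} N_j$, indexed by the same set $J$, where each summand is either indecomposable or zero, and such that $M_j$ and $N_j$ are $\epsilon$-interleaved for every $j \in J$. The bottleneck distance is $d_B(M,N) = \inf\{\epsilon \geq 0 : \text{there exists an } \epsilon\text{-matching between } M \text{ and } N\}$. A finitely presentable module $M : \mathbf{R}^n \to \mathbf{vec}$ is structurally stable if for every $\epsilon > 0$ there exists $\delta > 0$ such that every finitely presentable $N : \mathbf{R}^n \to \mathbf{vec}$ with $d_I(M,N) < \delta$ satisfies $d_B(M,N) < \epsilon$. *)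

(* Defs.v *)
From HB Require Import structures.
From mathcomp Require Import all_boot all_order all_algebra.
From mathcomp Require Import all_classical all_reals ereal.

Set Implicit Arguments.
Unset Strict Implicit.
Unset Printing Implicit Defensive.
Import Order.TTheory GRing.Theory Num.Theory.

Local Open Scope classical_set_scope.
Local Open Scope ring_scope.

(* The poset R^n: functions 'I_n -> R with their canonical (pointwise) order. *)
Definition Rn (R : realType) (n : nat) := 'I_n -> R.

Notation "s <=p t" := (Order.le (s : 'I_ _ -> _) (t : 'I_ _ -> _))
  (at level 70, no associativity).

Definition pshift (R : realType) (n : nat) (s : Rn R n) (r : R) : Rn R n :=
  fun i => s i + r.

Lemma pshift_le (R : realType) (n : nat) (r : R) (s t : Rn R n) :
  s <=p t -> pshift s r <=p pshift t r.
Proof. by move=> /asboolP st; apply/asboolP => i; rewrite lerD2r; apply: st. Qed.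

(* Functors R^n -> vec.  As [s <=p t] is a boolean, it has at most one proof,
   so there is a single structure map from [s] to [t]. *)
Record pmod (k : fieldType) (R : realType) (n : nat) := PMod {
  pm_obj :> Rn R n -> vectType k;
  pm_map : forall s t : Rn R n, s <=p t -> 'Hom(pm_obj s, pm_obj t);
  pm_map_id : forall s : Rn R n, pm_map (lexx s) = \1%VF;
  pm_map_comp : forall (s t u : Rn R n) (st : s <=p t) (tu : t <=p u),
    (pm_map tu \o pm_map st)%VF = pm_map (le_trans st tu)
}.
Arguments pm_map {k R n} M {s t} st : rename.

Record pmhom (k : fieldType) (R : realType) (n : nat) (M N : pmod k R n) := PMHom {
  hom_at :> forall s : Rn R n, 'Hom(M s, N s);
  hom_natural : forall (s t : Rn R n) (st : s <=p t),
    (pm_map N st \o hom_at s)%VF = (hom_at t \o pm_map M st)%VF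
}.

Definition pm_iso (k : fieldType) (R : realType) (n : nat) (M N : pmod k R n) :=
  exists (f : pmhom M N) (g : pmhom N M),
    (forall s, (g s \o f s)%VF = \1%VF) /\ (forall s, (f s \o g s)%VF = \1%VF).

Definition pm_is_zero (k : fieldType) (R : realType) (n : nat) (M : pmod k R n) :=
  forall (s : Rn R n) (x : M s), x = 0.

Section Zero.
Variables (k : fieldType) (R : realType) (n : nat).

Fact pm0_id (s : Rn R n) : (\1%VF : 'Hom('rV[k]_0, 'rV[k]_0)) = \1%VF.
Proof. by []. Qed.

Fact pm0_comp (s t u : Rn R n) (st : s <=p t) (tu : t <=p u) :
  (\1 \o \1)%VF = (\1%VF : 'Hom('rV[k]_0, 'rV[k]_0)).
Proof. exact: comp_lfun1l. Qed.

Definition pm0 : pmod k R n :=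
  @PMod k R n (fun=> 'rV[k]_0) (fun _ _ _ => \1%VF) pm0_id pm0_comp.

End Zero.

(* A boolean is coerced to 0 or 1 in nat, so P_i(j) is 'rV_1 when [i <=p j]
   holds and the zero space 'rV_0 otherwise; the map between two copies of 'rV_1
   is right multiplication by the 1 x 1 matrix with entry 1, that is, the
   identity. *)
Section Proj.
Variables (k : fieldType) (R : realType) (n : nat) (i : Rn R n).

Definition ones_map (b c : bool) : 'Hom('rV[k]_b, 'rV[k]_c) :=
  linfun (mulmxr (const_mx 1)).

Lemma ones_map_id (b : bool) : ones_map b b = \1%VF.
Proof.
apply/lfunP => x; rewrite lfunE id_lfunE /=; apply/matrixP.
by case: b x => x a [] // [] // lt0; rewrite !mxE big_ord1 mxE mulr1 ord1;
  congr (x _ _); apply: val_inj.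
Qed.

Lemma ones_map_comp (b c d : bool) : (b -> c) -> (c -> d) ->
  (ones_map c d \o ones_map b c)%VF = ones_map b d.
Proof.
move=> bc cd; apply/lfunP => x; rewrite comp_lfunE !lfunE /=.
case: b bc x => [bc|_] x; last by rewrite [x]thinmx0 !mul0mx.
rewrite (bc isT) (cd (bc isT)); apply/matrixP => u v.
by rewrite !mxE !big_ord1 !mxE !big_ord1 !mxE mulr1.
Qed.

Definition proj_map (s t : Rn R n) (st : s <=p t) :
    'Hom('rV[k]_(i <=p s), 'rV[k]_(i <=p t)) :=
  ones_map (i <=p s) (i <=p t).

Fact proj_map_id (s : Rn R n) : proj_map (lexx s) = \1%VF.
Proof. exact: ones_map_id. Qed.

Fact proj_map_comp (s t u : Rn R n) (st : s <=p t) (tu : t <=p u) :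
  (proj_map tu \o proj_map st)%VF = proj_map (le_trans st tu).
Proof.
by apply: ones_map_comp => [is_|it]; [apply: le_trans st|apply: le_trans tu].
Qed.

Definition pm_proj : pmod k R n :=
  @PMod k R n (fun j => 'rV[k]_(i <=p j)) proj_map proj_map_id proj_map_comp.

End Proj.

Section Sum.
Variables (k : fieldType) (R : realType) (n : nat).

Section PairMap.
Variables (U1 U2 V1 V2 : vectType k) (f : 'Hom(U1, V1)) (g : 'Hom(U2, V2)).

Definition pair_fun (u : U1 * U2) : V1 * V2 := (f u.1, g u.2).

Fact pair_fun_is_linear : linear pair_fun.
Proof. by move=> a u v; rewrite /pair_fun !linearP. Qed.

HB.instance Definition _ :=
  GRing.isLinear.Build k (U1 * U2)%type (V1 * V2)%type _ pair_fun
    pair_fun_is_linear.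

Definition pair_lfun : 'Hom((U1 * U2)%type, (V1 * V2)%type) := linfun pair_fun.

Lemma pair_lfunE u : pair_lfun u = (f u.1, g u.2).
Proof. exact: lfunE. Qed.

End PairMap.

Variables A B : pmod k R n.

Fact sum_map_id (s : Rn R n) :
  pair_lfun (pm_map A (lexx s)) (pm_map B (lexx s)) = \1%VF.
Proof.
by apply/lfunP => -[a b]; rewrite pair_lfunE !pm_map_id !id_lfunE.
Qed.

Fact sum_map_comp (s t u : Rn R n) (st : s <=p t) (tu : t <=p u) :
  (pair_lfun (pm_map A tu) (pm_map B tu) \o
   pair_lfun (pm_map A st) (pm_map B st))%VF =
  pair_lfun (pm_map A (le_trans st tu)) (pm_map B (le_trans st tu)).
Proof.
by apply/lfunP => x; rewrite comp_lfunE !pair_lfunE -!pm_map_comp !comp_lfunE.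
Qed.

Definition pm_sum : pmod k R n :=
  @PMod k R n (fun s => (A s * B s)%type)
    (fun s t st => pair_lfun (pm_map A st) (pm_map B st))
    sum_map_id sum_map_comp.

End Sum.

(* The direct sum of the P_i for i in a finite multiset, given as a list. *)
Definition pm_free (k : fieldType) (R : realType) (n : nat)
    (I : seq (Rn R n)) : pmod k R n :=
  foldr (fun i M => pm_sum (pm_proj k i) M) (pm0 k R n) I.

Definition is_cokernel (k : fieldType) (R : realType) (n : nat)
    (A B C : pmod k R n) (phi : pmhom A B) (pi : pmhom B C) :=
  (forall s, (pi s \o phi s)%VF = 0) /\
  (forall (X : pmod k R n) (h : pmhom B X),
     (forall s, (h s \o phi s)%VF = 0) ->
     exists u : pmhom C X,
       (forall s, (u s \o pi s)%VF = h s) /\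
       (forall u' : pmhom C X,
          (forall s, (u' s \o pi s)%VF = h s) -> forall s, u' s = u s)).

Definition fin_presentable (k : fieldType) (R : realType) (n : nat)
    (M : pmod k R n) :=
  exists (J I : seq (Rn R n)) (phi : pmhom (pm_free k J) (pm_free k I))
    (pi : pmhom (pm_free k I) M), is_cokernel phi pi.

Definition decomposable (k : fieldType) (R : realType) (n : nat)
    (M : pmod k R n) :=
  exists A B : pmod k R n,
    [/\ ~ pm_is_zero A, ~ pm_is_zero B & pm_iso M (pm_sum A B)].

Definition indecomposable (k : fieldType) (R : realType) (n : nat)
    (M : pmod k R n) :=
  ~ pm_is_zero M /\ ~ decomposable M.

Section Shift.
Variables (k : fieldType) (R : realType) (n : nat) (M : pmod k R n) (r : R).

Fact shift_map_id (s : Rn R n) :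
  pm_map M (pshift_le r (lexx s)) = \1%VF.
Proof. by rewrite (bool_irrelevance (pshift_le r _) (lexx _)) pm_map_id. Qed.

Fact shift_map_comp (s t u : Rn R n) (st : s <=p t) (tu : t <=p u) :
  (pm_map M (pshift_le r tu) \o pm_map M (pshift_le r st))%VF =
  pm_map M (pshift_le r (le_trans st tu)).
Proof.
by rewrite pm_map_comp; congr (pm_map M _); apply: bool_irrelevance.
Qed.

Definition pm_shift : pmod k R n :=
  @PMod k R n (fun s => M (pshift s r))
    (fun s t st => pm_map M (pshift_le r st)) shift_map_id shift_map_comp.

End Shift.

(* The component of g[e] at s is g at s + e; M[e][e] and M[2e] are identified,
   so the component at s of the natural transformation from M to M[2e] is the
   structure map from s to (s + e) + e. *)
Definition interleaved (k : fieldType) (R : realType) (n : nat) (e : R)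
    (M N : pmod k R n) :=
  0 <= e /\
  exists (f : pmhom M (pm_shift N e)) (g : pmhom N (pm_shift M e)),
    forall (s : Rn R n) (h : s <=p pshift (pshift s e) e),
      (g (pshift s e) \o f s)%VF = pm_map M h /\
      (f (pshift s e) \o g s)%VF = pm_map N h.

Definition dI (k : fieldType) (R : realType) (n : nat) (M N : pmod k R n) :
    \bar R :=
  ereal_inf [set e%:E | e in [set e : R | interleaved e M N]].

(* M is isomorphic to the direct sum of the family Mj, over an arbitrary set
   J: there are morphisms iota_j : Mj j -> M for which, at every s, each
   element of M s is the sum of the iota_j (v_j) for exactly one finitely
   supported family v, that is, the induced linear map from the direct sum of
   the (Mj j) s to M s is bijective. *)
Definition is_direct_sum (k : fieldType) (R : realType) (n : nat)
    (J : choiceType) (Mj : J -> pmod k R n) (M : pmod k R n) :=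
  exists iota : forall j : J, pmhom (Mj j) M,
    forall (s : Rn R n) (x : M s),
      exists! v : (forall j : J, Mj j s),
        finite_set [set j | v j != 0] /\
        x = \sum_(j \in [set: J]) iota j s (v j).

Definition matching (k : fieldType) (R : realType) (n : nat) (e : R)
    (M N : pmod k R n) :=
  0 <= e /\
  exists (J : choiceType) (Mj Nj : J -> pmod k R n),
    [/\ is_direct_sum Mj M, is_direct_sum Nj N,
        forall j, indecomposable (Mj j) \/ pm_is_zero (Mj j),
        forall j, indecomposable (Nj j) \/ pm_is_zero (Nj j) &
        forall j, interleaved e (Mj j) (Nj j)].

Definition dB (k : fieldType) (R : realType) (n : nat) (M N : pmod k R n) :
    \bar R :=
  ereal_inf [set e%:E | e in [set e : R | matching e M N]].

Definition structurally_stable (k : fieldType) (R : realType) (n : nat)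
    (M : pmod k R n) :=
  forall e : R, 0 < e ->
  exists2 d : R, 0 < d &
    forall N : pmod k R n, fin_presentable N ->
      (dI M N < d%:E)%E -> (dB M N < e%:E)%E.

(* Main.v *)
(** A finitely presentable module is M(s) = A(s)/B(s), where A(s) and B(s) are
    spanned, inside one fixed vector space, by the generators and the relations
    of degree at most s.  Since there are finitely many degrees, there is g > 0
    such that M(p) -> M(p + g) is injective at every degree p.  Hence a nonzero
    summand of M is not e-interleaved with 0 for small e, and every morphism
    M -> M[2e] factors through M -> M[2e] by an endomorphism of M.

    If M is not decomposable, (f, g) is an e-interleaving of M and N and
    N = (+)_j N_j with N_j indecomposable, then g p_j f comes from an endomorphism
    phi_j of M; the phi_j are orthogonal idempotents with sum 1, so one of them is
    1 and the others vanish: one N_j is e-interleaved with M, and the others are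
    2e-interleaved with 0.

    Conversely, for every d > 0 there is N, d-interleaved with M, without
    nontrivial idempotent.  Up to small shifts, each generator t of M is doubled
    into gen1 t and gen2 t, of incomparable degrees, whose difference is set equal
    to a new generator, thin t, which starts very far to the left and is killed
    after a short diagonal shift.  The degrees of the thin t form an antichain, and
    far to the left one relation ties all of them together.  An idempotent acts on
    thin t as a scalar, which is the same for all t and so is 0 or 1; if it is 0,
    the links thin t = gen1 t - gen2 t make the idempotent strictly triangular.
    If M is stable, a matching between M and such an N has at most one nonzero
    summand on the side of N, hence on the side of M. *)

From HB Require Import structures.
Require Import Defs.
From mathcomp Require Import all_boot all_order all_algebra.
From mathcomp Require Import all_classical all_reals ereal.
From mathcomp Require Import finmap ring lra.

Set Implicit Arguments.
Unset Strict Implicit.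
Unset Printing Implicit Defensive.
Import Order.TTheory GRing.Theory Num.Theory.

Local Open Scope classical_set_scope.
Local Open Scope ring_scope.

(** * Morphisms, isomorphisms and cokernels *)

Lemma lfun_of (k : fieldType) (U W : vectType k) (f : U -> W) :
  linear f -> {F : 'Hom(U, W) | F =1 f}.
Proof.
move=> lf.
pose g : {linear U -> W} :=
  HB.pack_for {linear U -> W} f (GRing.isLinear.Build _ _ _ _ f lf).
by exists (linfun g) => u; rewrite lfunE.
Qed.

Lemma lfun_surjVK (k : fieldType) (U W : vectType k) (f : 'Hom(U, W)) :
  (forall y, exists x, f x = y) -> cancel f^-1%VF f.
Proof.
by move=> fS y; apply: limg_lfunVK; case: (fS y) => x <-; apply: memv_img (memvf x).
Qed.

Lemma lfun_injK (k : fieldType) (U W : vectType k) (f : 'Hom(U, W)) :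
  (forall x, f x = 0 -> x = 0) -> cancel f f^-1%VF.
Proof.
move=> f0; apply: lker0_lfunK; apply/lker0P => x y fxy.
by apply/eqP; rewrite -subr_eq0; apply/eqP/f0; rewrite linearB /= fxy subrr.
Qed.

Section Modules.
Variables (k : fieldType) (R : realType) (n : nat).
Implicit Types (M N X : pmod k R n) (s t : Rn R n).

Lemma pm_map_id_at M s (ss : s <=p s) x : pm_map M ss x = x.
Proof. by rewrite (bool_irrelevance ss (lexx s)) pm_map_id id_lfunE. Qed.

Lemma pm_map_comp_at M s t u (st : s <=p t) (tu : t <=p u) (su : s <=p u) x :
  pm_map M tu (pm_map M st x) = pm_map M su x.
Proof.
by rewrite -comp_lfunE pm_map_comp (bool_irrelevance su (le_trans st tu)).
Qed.

Lemma pm_mapM M s t u (st : s <=p t) (tu : t <=p u) x :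
  pm_map M tu (pm_map M st x) = pm_map M (le_trans st tu) x.
Proof. exact: pm_map_comp_at. Qed.

Lemma pm_map_irr M s t (st st' : s <=p t) x : pm_map M st x = pm_map M st' x.
Proof. by rewrite (bool_irrelevance st st'). Qed.

Lemma hom_nat M N (f : pmhom M N) s t (st : s <=p t) x :
  pm_map N st (f s x) = f t (pm_map M st x).
Proof. by rewrite -!comp_lfunE hom_natural. Qed.

Section HomOf.
Variables (M N : pmod k R n) (h : forall s, 'Hom(M s, N s)).
Hypothesis h_nat : forall s t (st : s <=p t) x,
  pm_map N st (h s x) = h t (pm_map M st x).

Fact hom_of_natural s t (st : s <=p t) :
  (pm_map N st \o h s)%VF = (h t \o pm_map M st)%VF.
Proof. by apply/lfunP => x; rewrite !comp_lfunE h_nat. Qed.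

Definition hom_of : pmhom M N := PMHom hom_of_natural.

End HomOf.

Fact hom_comp_nat M N X (f : pmhom M N) (g : pmhom N X) s t (st : s <=p t) x :
  pm_map X st ((g s \o f s)%VF x) = (g t \o f t)%VF (pm_map M st x).
Proof. by rewrite !comp_lfunE !hom_nat. Qed.

Definition hom_comp M N X (g : pmhom N X) (f : pmhom M N) : pmhom M X :=
  hom_of (hom_comp_nat f g).

Lemma hom_compE M N X (g : pmhom N X) (f : pmhom M N) s x :
  hom_comp g f s x = g s (f s x).
Proof. exact: comp_lfunE. Qed.

Fact hom_id_nat M s t (st : s <=p t) x :
  pm_map M st ((\1%VF : 'End(M s)) x) = (\1%VF : 'End(M t)) (pm_map M st x).
Proof. by rewrite !id_lfunE. Qed.

Definition hom_id M : pmhom M M := hom_of (@hom_id_nat M).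

Lemma hom_idE M s x : hom_id M s x = x.
Proof. exact: id_lfunE. Qed.

Lemma pm_isoI M N (f : pmhom M N) (g : pmhom N M) :
  (forall s x, g s (f s x) = x) -> (forall s x, f s (g s x) = x) -> pm_iso M N.
Proof.
by move=> gf fg; exists f, g; split=> s; apply/lfunP => x;
  rewrite comp_lfunE id_lfunE.
Qed.

Lemma pm_isoE M N : pm_iso M N -> exists (f : pmhom M N) (g : pmhom N M),
  (forall s x, g s (f s x) = x) /\ (forall s x, f s (g s x) = x).
Proof.
move=> [f [g [gf fg]]]; exists f, g; split=> s x.
  by rewrite -comp_lfunE gf id_lfunE.
by rewrite -comp_lfunE fg id_lfunE.
Qed.

Lemma pm_iso_sym M N : pm_iso M N -> pm_iso N M.
Proof. by move=> [f [g [gf fg]]]; exists g, f. Qed.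

Lemma pm_iso_trans M N X : pm_iso M N -> pm_iso N X -> pm_iso M X.
Proof.
move=> /pm_isoE[f [f' [ff' f'f]]] /pm_isoE[g [g' [gg' g'g]]].
apply: (@pm_isoI _ _ (hom_comp g f) (hom_comp f' g')) => s x; rewrite !hom_compE.
  by rewrite gg' ff'.
by rewrite f'f g'g.
Qed.

Lemma iso_zero M N : pm_iso M N -> pm_is_zero N -> pm_is_zero M.
Proof.
by move=> /pm_isoE[f [g [gf _]]] N0 s x; rewrite -(gf s x) (N0 s (f s x)) linear0.
Qed.

Lemma iso_indecomposable_or_zero M N : pm_iso M N ->
  indecomposable N \/ pm_is_zero N -> indecomposable M \/ pm_is_zero M.
Proof.
move=> MN [[N0 Nd]|N0]; last by right; apply: iso_zero N0.
left; split; first by move=> M0; apply/N0/(iso_zero (pm_iso_sym MN)).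
move=> [A [B [A0 B0 MAB]]]; apply: Nd; exists A, B; split=> //.
exact: pm_iso_trans (pm_iso_sym MN) MAB.
Qed.

(* M(s) is presented as A(s)/B(s) inside a vector space V that does not depend
   on s, the structure maps being induced by the identity of V; [q s] is only
   meaningful on [A s]. *)
Record subquot (V : vectType k) (A B : Rn R n -> {vspace V}) M
    (q : forall s, 'Hom(V, M s)) : Prop := Subquot {
  sq_surj : forall s x, exists2 v, v \in A s & q s v = x;
  sq_ker : forall s v, v \in A s -> (q s v == 0) = (v \in B s);
  sq_nat : forall s t (st : s <=p t) v, v \in A s -> pm_map M st (q s v) = q t v
}.

Section Subquot.
Variables (V : vectType k) (A B : Rn R n -> {vspace V}).
Hypothesis A_mono : forall s t, s <=p t -> (A s <= A t)%VS.

(** Universal property of the quotient: any linear choice of representatives in [A s] defines the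
    morphism, because [h] kills [B s]. *)
Lemma sq_desc M (q : forall s, 'Hom(V, M s)) X (h : forall s, 'Hom(V, X s)) :
  subquot A B q ->
  (forall s v, v \in A s -> v \in B s -> h s v = 0) ->
  (forall s t (st : s <=p t) v, v \in A s -> pm_map X st (h s v) = h t v) ->
  exists u : pmhom M X, forall s v, v \in A s -> u s (q s v) = h s v.
Proof.
move=> [qS qK qN] h0 hN.
(* Restricting [q s] to [A s] by the projector forces the chosen preimages into [A s], the only
   place where [q s] is controlled. *)
pose f s := (q s \o projv (A s))%VF.
have [g gA qg] : exists2 g : forall s, 'Hom(M s, V),
    forall s x, g s x \in A s & forall s x, q s (g s x) = x.
  exists (fun s => (projv (A s) \o (f s)^-1)%VF) => s x.
    by rewrite comp_lfunE memv_proj.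
  have VK : cancel (f s)^-1%VF (f s).
    apply: lfun_surjVK => y; have [v Av <-] := qS s y.
    by exists v; rewrite /f comp_lfunE projv_id.
  by rewrite -[RHS]VK /f !comp_lfunE.
have hE s v w : v \in A s -> w \in A s -> q s v = q s w -> h s v = h s w.
  move=> Av Aw qvw; apply/eqP; rewrite -subr_eq0 -linearB; apply/eqP.
  have Avw : v - w \in A s by rewrite rpredB.
  by apply: h0 => //; rewrite -qK // linearB /= qvw subrr.
have un s t (st : s <=p t) x :
    pm_map X st ((h s \o g s)%VF x) = (h t \o g t)%VF (pm_map M st x).
  rewrite !comp_lfunE hN ?gA //; apply: hE.
  - exact: (subvP (A_mono st)).
  - exact: gA.
  - by rewrite qg -(qN _ _ st) ?gA // qg.
exists (hom_of un) => s v Av /=.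
by rewrite comp_lfunE; apply: hE; rewrite ?qg.
Qed.

Lemma sq_iso M N (q : forall s, 'Hom(V, M s)) : subquot A B q -> pm_iso M N ->
  exists q' : forall s, 'Hom(V, N s), subquot A B q'.
Proof.
move=> [qS qK qN] /pm_isoE[f [g [gf fg]]].
exists (fun s => (f s \o q s)%VF); split=> [s x|s v Av|s t st v Av].
- by have [v Av qv] := qS s (g s x); exists v => //; rewrite comp_lfunE qv.
- rewrite comp_lfunE -qK //; apply/eqP/eqP => [fq0|->]; last exact: linear0.
  by rewrite -(gf s (q s v)) fq0 linear0.
- by rewrite !comp_lfunE hom_nat qN.
Qed.

Hypothesis B_mono : forall s t, s <=p t -> (B s <= B t)%VS.
Hypothesis B_sub : forall s, (B s <= A s)%VS.

(** The quotient of [A s] by [B s] is realised as a complement of [B s] in [A s], the quotient map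
    as the projection along [B s]. A structure map projects the old representative again. *)
Let sq_obj s : vectType k := subvs_of (A s :\: B s)%VS.

Let sq_q s : 'Hom(V, sq_obj s) :=
  (linfun (vsproj (A s :\: B s)%VS) \o addv_pi1 (A s) (B s))%VF.

Let sq_map s t : 'Hom(sq_obj s, sq_obj t) := (sq_q t \o linfun vsval)%VF.

Let sq_qE s v : vsval (sq_q s v) = addv_pi1 (A s) (B s) v.
Proof. by rewrite comp_lfunE lfunE /= vsprojK // /addv_pi1 memv_pi. Qed.

Let sq_mod s v : v \in A s -> v - vsval (sq_q s v) \in B s.
Proof.
move=> Av; have vAB : v \in (A s + B s)%VS.
  by apply: (subvP (addvSl _ _)).
by rewrite sq_qE -{1}(addv_pi1_pi2 vAB) addrC addKr memv_pi2.
Qed.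

Let sq_q0 s v : v \in A s -> (sq_q s v == 0) = (v \in B s).
Proof.
move=> Av; have vB := sq_mod Av; apply/eqP/idP => [q0|Bv].
  by move: vB; rewrite q0 [vsval _]linear0 subr0.
apply: subvs_inj; rewrite [RHS]linear0.
have: vsval (sq_q s v) \in ((A s :\: B s) :&: B s)%VS.
  rewrite memv_cap subvsP /=.
  by rewrite -[X in X \in _](subKr v) rpredB.
by rewrite capv_diff memv0 => /eqP.
Qed.

Let sq_mapE s t x : sq_map s t x = sq_q t (vsval x).
Proof. by rewrite [LHS]comp_lfunE; congr (sq_q t _); exact: lfunE. Qed.

Let sq_qN s t v : s <=p t -> v \in A s -> sq_map s t (sq_q s v) = sq_q t v.
Proof.
move=> st Av; rewrite sq_mapE; apply/eqP; rewrite eq_sym -subr_eq0.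
  rewrite -linearB.
have vB := sq_mod Av; rewrite sq_q0 ?(subvP (B_mono st)) //.
by apply: (subvP (A_mono st)); apply: (subvP (B_sub s)).
Qed.

Let sq_qK s x : sq_q s (vsval x) = x.
Proof.
have Ax : vsval x \in A s by apply: (subvP (diffvSl _ (B s))); apply: subvsP.
apply: subvs_inj; apply/eqP; rewrite eq_sym -subr_eq0 -memv0 -(capv_diff (A s) (B s)).
by rewrite memv_cap andbC sq_mod //= rpredB // subvsP.
Qed.

Let sq_A s (x : sq_obj s) : vsval x \in A s.
Proof. by apply: (subvP (diffvSl _ (B s))); apply: subvsP. Qed.

Let sq_map_id s : sq_map s s = \1%VF.
Proof.
by apply/lfunP => x; rewrite id_lfunE -{1}(sq_qK x) sq_qN ?sq_qK.
Qed.

Let sq_map_comp s t u (st : s <=p t) (tu : t <=p u) :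
  (sq_map t u \o sq_map s t)%VF = sq_map s u.
Proof.
apply/lfunP => x; rewrite comp_lfunE -(sq_qK x) !sq_qN //.
  exact: le_trans st tu.
by apply: (subvP (A_mono st)).
Qed.

Lemma sq_ex : exists M (q : forall s, 'Hom(V, M s)), subquot A B q.
Proof.
exists (@PMod k R n sq_obj (fun s t _ => sq_map s t) sq_map_id
         (fun s t u st tu => sq_map_comp st tu)), sq_q.
split=> [s x|s v|s t st v] /=.
- by exists (vsval x); [apply: sq_A | apply: sq_qK].
- exact: sq_q0.
- exact: sq_qN.
Qed.

End Subquot.

(** A linear section of [pi s] is chosen at each [s] with no compatibility. By exactness the value
    of [h] does not depend on the preimage, which gives naturality. *)
Lemma pointwise_cokernel (A B C : pmod k R n) (phi : pmhom A B) (pi : pmhom B C) :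
  (forall s y, exists x, pi s x = y) ->
  (forall s x, pi s x = 0 <-> exists y, phi s y = x) -> is_cokernel phi pi.
Proof.
move=> piS piK; split=> [s|X h h0].
  by apply/lfunP => x; rewrite comp_lfunE zero_lfunE; apply/piK; exists x.
have VK s : cancel (pi s)^-1%VF (pi s) by apply: lfun_surjVK; apply: piS.
have hE s x y : pi s x = pi s y -> h s x = h s y.
  move=> pxy; have: pi s (x - y) = 0 by rewrite linearB /= pxy subrr.
  move=> /piK[z zE]; apply/eqP; rewrite -subr_eq0 -linearB -zE /=.
  by have /lfunP/(_ z) := h0 s; rewrite comp_lfunE zero_lfunE => ->.
have un s t (st : s <=p t) x : pm_map X st ((h s \o (pi s)^-1)%VF x) =
    (h t \o (pi t)^-1)%VF (pm_map C st x).
  by rewrite !comp_lfunE hom_nat; apply: hE; rewrite VK -hom_nat VK.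
exists (hom_of un); split=> [s|u' u'h s] /=.
  by apply/lfunP => x; rewrite !comp_lfunE; apply: hE; rewrite VK.
by apply/lfunP => x; rewrite comp_lfunE -u'h comp_lfunE VK.
Qed.

Lemma cokernel_iso (A B C D : pmod k R n) (phi : pmhom A B) (pi : pmhom B C) (rho : pmhom B D) :
  is_cokernel phi pi -> is_cokernel phi rho -> pm_iso C D.
Proof.
move=> [pi0 piU] [rho0 rhoU].
have [f [fE fU]] := piU _ _ rho0; have [g [gE gU]] := rhoU _ _ pi0.
have fP t y : f t (pi t y) = rho t y by rewrite -comp_lfunE fE.
have gP t y : g t (rho t y) = pi t y by rewrite -comp_lfunE gE.
have [u [_ uU]] := piU _ _ pi0; have [v [_ vU]] := rhoU _ _ rho0.
apply: (@pm_isoI _ _ f g) => s x.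
  rewrite -hom_compE (uU (hom_comp g f)) -?(uU (hom_id C)) ?hom_idE // => t.
    by apply/lfunP => y; rewrite comp_lfunE hom_idE.
  by apply/lfunP => y; rewrite comp_lfunE hom_compE fP gP.
rewrite -hom_compE (vU (hom_comp f g)) -?(vU (hom_id D)) ?hom_idE // => t.
  by apply/lfunP => y; rewrite comp_lfunE hom_idE.
by apply/lfunP => y; rewrite comp_lfunE hom_compE gP fP.
Qed.

End Modules.

(** * Finite presentations *)

Section Coordinates.
Variables (k : fieldType) (T : finType).
Local Notation V := {ffun T -> k^o}.

Definition basis_vec (t : T) : V := [ffun x => (x == t)%:R].

Lemma basis_vecE t x : basis_vec t x = (x == t)%:R.
Proof. exact: ffunE. Qed.

Definition lincomb (W : vectType k) (f : T -> W) : 'Hom(V, W).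
Proof.
apply: (projT1 (@lfun_of k V W (fun v => \sum_t v t *: f t) _)).
move=> c u v; rewrite scaler_sumr -big_split /=; apply: eq_bigr => t _.
by rewrite !ffunE scalerDl scalerA.
Defined.

Lemma lincombE (W : vectType k) (f : T -> W) v :
  lincomb f v = \sum_t v t *: f t.
Proof. exact: (projT2 (lfun_of _)). Qed.

Lemma lincomb_basis (W : vectType k) (f : T -> W) t :
  lincomb f (basis_vec t) = f t.
Proof.
rewrite lincombE (bigD1 t) //= basis_vecE eqxx scale1r big1 ?addr0 // => x xt.
by rewrite basis_vecE (negPf xt) scale0r.
Qed.

Lemma sum_basis (v : V) : v = \sum_t v t *: basis_vec t.
Proof.
apply/ffunP => x; rewrite sum_ffunE (bigD1 x) //= big1 => [|t tx].
  by rewrite addr0 !ffunE eqxx [_ *: _]mulr1.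
by rewrite !ffunE eq_sym (negPf tx) scaler0.
Qed.

Lemma lfun_basis (W : vectType k) (L : 'Hom(V, W)) v :
  L v = \sum_t v t *: L (basis_vec t).
Proof. by rewrite {1}[v]sum_basis linear_sum; apply: eq_bigr => t _; rewrite linearZ. Qed.

Variables (R : realType) (n : nat) (a : T -> Rn R n).

Definition gens (s : Rn R n) : {vspace V} :=
  <<[seq basis_vec t | t <- enum T & a t <=p s]>>%VS.

Lemma gensP s (v : V) : reflect (forall t, v t != 0 -> a t <=p s) (v \in gens s).
Proof.
apply: (iffP idP) => [vs t|vs].
  apply: contraR => ats; have [F FE] : {F : 'Hom(V, k^o) | F =1 fun v => v t}.
    by apply: lfun_of => c u w; rewrite !ffunE.
  have /subvP/(_ v vs) : (gens s <= lker F)%VS.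
    apply/span_subvP => _ /mapP[x + ->]; rewrite mem_filter => /andP[ax _].
    rewrite memv_ker FE basis_vecE; case: (eqVneq t x) => // tx.
    by rewrite tx ax in ats.
  by rewrite memv_ker FE.
rewrite [v]sum_basis; apply: rpred_sum => t _.
have [->|vt] := eqVneq (v t) 0; first by rewrite scale0r rpred0.
apply: rpredZ; apply: memv_span; apply: map_f.
by rewrite mem_filter vs // mem_enum.
Qed.

Lemma basis_gens t s : (basis_vec t \in gens s) = (a t <=p s).
Proof.
apply/gensP/idP => [/(_ t)|ts x]; rewrite basis_vecE.
  by rewrite eqxx oner_eq0; apply.
by case: (eqVneq x t) => [->|_] //; rewrite eqxx.
Qed.

Lemma gens_mono s t : s <=p t -> (gens s <= gens t)%VS.
Proof.
move=> st; apply/subvP => v /gensP vs; apply/gensP => x /vs xs.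
exact: le_trans xs st.
Qed.

End Coordinates.

Section Relations.
Variables (k : fieldType) (R : realType) (n : nat) (T U : finType).
Variables (a : T -> Rn R n) (b : U -> Rn R n) (X : U -> {ffun T -> k^o}).

Definition rels (s : Rn R n) : {vspace {ffun T -> k^o}} :=
  (lincomb X @: gens k b s)%VS.

Lemma rels_basis u s : b u <=p s -> X u \in rels s.
Proof. by move=> us; rewrite -(lincomb_basis X u) memv_img // basis_gens. Qed.

Lemma rels_mono s t : s <=p t -> (rels s <= rels t)%VS.
Proof. by move=> st; apply: limgS; apply: gens_mono. Qed.

Lemma rels_ind (W : {vspace {ffun T -> k^o}}) s :
  (forall u, b u <=p s -> X u \in W) -> (rels s <= W)%VS.
Proof.
move=> XW; apply/subvP => _ /memv_imgP[w /gensP ws ->].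
rewrite lincombE; apply: rpred_sum => u _.
have [->|wu] := eqVneq (w u) 0; first by rewrite scale0r rpred0.
by apply: rpredZ; apply: XW; apply: ws.
Qed.

Hypothesis X_gens : forall u, X u \in gens k a (b u).

Lemma rels_sub s : (rels s <= gens k a s)%VS.
Proof. by apply: rels_ind => u us; apply: (subvP (gens_mono k a us)). Qed.

End Relations.

Section Embedding.
Variables (k : fieldType) (R : realType) (n : nat) (T : finType).
Variable (a : T -> Rn R n).
Local Notation V := {ffun T -> k^o}.

(** Free modules embed in a space independent of [s]. A summand at [s] consists of row vectors of
    width 0 or 1, and summing the entries reads the coordinate in both cases without a case
    distinction in the type. *)
Fixpoint emb_fun s (ts : seq T) : pm_free k (map a ts) s -> V :=
  match ts return pm_free k (map a ts) s -> V with
  | [::] => fun=> 0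
  | t :: ts' => fun x => (\sum_i x.1 0 i) *: basis_vec k t + emb_fun x.2
  end.

Lemma emb_fun_linear s ts : linear (@emb_fun s ts).
Proof.
elim: ts => [|t ts IH] c x y /=; first by rewrite scaler0 addr0.
rewrite IH scalerDr addrACA scalerA -scalerDl; congr (_ *: _ + _).
by rewrite mulr_sumr -big_split; apply: eq_bigr => i _; rewrite !mxE.
Qed.

Lemma ones_map_sum (b c : bool) (x : 'rV[k]_b) : (b -> c) ->
  \sum_i ones_map k b c x 0 i = \sum_i x 0 i.
Proof.
rewrite lfunE /=; case: b x => x bc; last first.
  by rewrite [RHS]big_ord0 big1 // => i _; rewrite !mxE big_ord0.
by rewrite bc // !big_ord1 !mxE big_ord1 mxE mulr1.
Qed.

Lemma emb_fun_nat s t ts (st : s <=p t) (x : pm_free k (map a ts) s) :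
  emb_fun (pm_map (pm_free k (map a ts)) st x) = emb_fun x.
Proof.
elim: ts x => [|u ts IH] //= -[x y]; rewrite pair_lfunE /= IH; congr (_ *: _ + _).
apply: ones_map_sum => us; exact: le_trans us st.
Qed.

Lemma emb_fun_supp s ts (x : pm_free k (map a ts) s) t :
  emb_fun x t != 0 -> (t \in ts) && (a t <=p s).
Proof.
elim: ts x t => [|u ts IH] /= x t; first by rewrite ffunE eqxx.
rewrite !ffunE in_cons; case: (eqVneq t u) => [->|tu]; last first.
  by rewrite scaler0 add0r => /IH.
move=> + /=; apply: contraNT => us; rewrite big1 => [|[i lti]].
  by rewrite scale0r add0r; apply: contraNT us => /IH /andP[].
by exfalso; move: lti; rewrite (negPf us).
Qed.

Lemma emb_fun_inj s ts (x : pm_free k (map a ts) s) :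
  uniq ts -> emb_fun x = 0 -> x = 0.
Proof.
elim: ts x => [|u ts IH] /= x; first by move=> _ _; rewrite [x]thinmx0.
case: x => x y /andP[uts ts_uniq] /= xy0.
have yu0 : emb_fun y u = 0.
  by apply: contraNeq uts => /emb_fun_supp /andP[].
have x0 : \sum_i x 0 i = 0.
  by move/ffunP/(_ u): xy0; rewrite !ffunE eqxx yu0 addr0 [_ *: _]mulr1.
rewrite (IH y) //; last by move: xy0; rewrite x0 scale0r add0r.
congr pair; apply/matrixP => i j; rewrite ord1 mxE.
case: (a u <=p s) x x0 j {xy0} => x x0 [] // [] // lt; move: x0; rewrite big_ord1.
by move=> <-; congr (x _ _); apply: val_inj.
Qed.

Lemma emb_fun_surj s ts (v : V) : uniq ts ->
  (forall t, v t != 0 -> (t \in ts) && (a t <=p s)) ->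
  exists x : pm_free k (map a ts) s, emb_fun x = v.
Proof.
elim: ts v => [|u ts IH] v /= => [_|/andP[uts ts_uniq]] vts.
  by exists 0; apply/ffunP => t; rewrite ffunE; apply/esym/eqP/negPn/negP => /vts.
pose w : V := [ffun t => if t == u then 0 else v t].
have [||y yE] := IH w => // [t|].
  rewrite ffunE; case: (eqVneq t u) => [_|tu /vts]; first by rewrite eqxx.
  by rewrite in_cons (negPf tu).
exists (const_mx (v u), y); rewrite yE; apply/ffunP => t; rewrite !ffunE.
case: (eqVneq t u) => [->|_]; last by rewrite scaler0 add0r.
rewrite addr0 [_ *: _]mulr1 (eq_bigr (fun=> v u)) => [|i _]; last by rewrite mxE.
rewrite sumr_const card_ord.
have [_|] := boolP (a u <=p s); first by rewrite mulr1n.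
by move=> us; have [->|/vts /andP[_]] := eqVneq (v u) 0; rewrite ?mulr0n ?(negPf us).
Qed.

Definition free_mod : pmod k R n := pm_free k (map a (enum T)).

Lemma emb_ex : exists emb : forall s, 'Hom(free_mod s, V),
  [/\ forall s t (st : s <=p t) x, emb t (pm_map free_mod st x) = emb s x,
      forall s x, emb s x = 0 -> x = 0,
      forall s x, emb s x \in gens k a s
    & forall s (v : V), v \in gens k a s -> exists x, emb s x = v].
Proof.
have emb s := projT2 (lfun_of (@emb_fun_linear s (enum T))).
exists (fun s => projT1 (lfun_of (@emb_fun_linear s (enum T)))).
split=> [s t st x|s x|s x|s v /gensP vs]; rewrite ?emb.
- exact: emb_fun_nat.
- exact/emb_fun_inj/enum_uniq.
- by apply/gensP => t /emb_fun_supp /andP[].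
have [|t /vs ->|x xE] := @emb_fun_surj s (enum T) v; rewrite ?enum_uniq //.
  by rewrite mem_enum.
by exists x; rewrite emb.
Qed.

End Embedding.

Section Presentations.
Variables (k : fieldType) (R : realType) (n : nat).

(** The presenting morphism is [lincomb X] transported to the free modules; it can be pulled back
    through the embedding because each [X u] only uses generators present at [b u]. *)
Lemma fp_of_pres (T U : finType) (a : T -> Rn R n) (b : U -> Rn R n)
    (X : U -> {ffun T -> k^o}) (M : pmod k R n) q :
  (forall u, X u \in gens k a (b u)) ->
  subquot (gens k a) (rels b X) (M := M) q -> fin_presentable M.
Proof.
move=> Xg [qS qK qN].
have [ea [ea_nat ea_inj ea_gens ea_surj]] := emb_ex k a.
have [eb [eb_nat eb_inj eb_gens eb_surj]] := emb_ex k b.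
have eaVK s v : v \in gens k a s -> ea s ((ea s)^-1%VF v) = v.
  by move=> /ea_surj[x <-]; rewrite lfun_injK //; apply: ea_inj.
have Xe s y : lincomb X (eb s y) \in gens k a s.
  by apply: (subvP (rels_sub Xg _)); apply: memv_img.
pose ph s := ((ea s)^-1 \o (lincomb X \o eb s))%VF.
have phE s y : ea s (ph s y) = lincomb X (eb s y).
  by rewrite !comp_lfunE eaVK.
have ph_nat s t (st : s <=p t) y :
    pm_map (free_mod k a) st (ph s y) = ph t (pm_map (free_mod k b) st y).
  apply/eqP; rewrite -subr_eq0; apply/eqP/(ea_inj t).
  by rewrite linearB /= ea_nat !phE eb_nat subrr.
have pi_nat s t (st : s <=p t) y :
    pm_map M st ((q s \o ea s)%VF y) =
    (q t \o ea t)%VF (pm_map (free_mod k a) st y).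
  by rewrite !comp_lfunE ea_nat (qN _ _ st).
exists (map b (enum U)), (map a (enum T)), (hom_of ph_nat), (hom_of pi_nat).
apply: pointwise_cokernel => s x.
  have [v /ea_surj[y <-] <-] := qS s x.
  by exists y; rewrite /= comp_lfunE.
rewrite [hom_of pi_nat s]/= comp_lfunE; split=> [/eqP|[y <-]]; last first.
  by rewrite phE; apply/eqP; rewrite qK // memv_img.
rewrite qK // => /memv_imgP[_ /eb_surj[y <-] xy].
exists y; apply/eqP; rewrite -subr_eq0; apply/eqP/(ea_inj s).
by rewrite linearB /= phE xy subrr.
Qed.

Lemma seq_family (I : seq (Rn R n)) :
  exists (T : finType) (a : T -> Rn R n), I = map a (enum T).
Proof. by exists 'I_(size I), (tnth (in_tuple I)); rewrite map_tnth_enum. Qed.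

(** [X u] is the image under [phi] of the basis element [u] at its own degree; by naturality this
    determines [phi] everywhere. The subquotient built from [X] and [M] are then two cokernels of
    [phi]. *)
Lemma pres_of_fp (M : pmod k R n) : fin_presentable M ->
  exists (T U : finType) (a : T -> Rn R n) (b : U -> Rn R n)
      (X : U -> {ffun T -> k^o}) (q : forall s, 'Hom({ffun T -> k^o}, M s)),
    (forall u, X u \in gens k a (b u)) /\ subquot (gens k a) (rels b X) q.
Proof.
move=> [J [I [phi [pi]]]].
have [T [a IE]] := seq_family I; have [U [b JE]] := seq_family J.
move: phi pi; rewrite {}IE {}JE => phi pi phipi.
have [ea [ea_nat ea_inj ea_gens ea_surj]] := emb_ex k a.
have [eb [eb_nat eb_inj eb_gens eb_surj]] := emb_ex k b.
have ebVK s v : v \in gens k b s -> eb s ((eb s)^-1%VF v) = v.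
  by move=> /eb_surj[x <-]; rewrite lfun_injK //; apply: eb_inj.
pose X u := ea (b u) (phi (b u) ((eb (b u))^-1%VF (basis_vec k u))).
have Xg u : X u \in gens k a (b u) by apply: ea_gens.
have Xphi s y : ea s (phi s y) = lincomb X (eb s y).
  rewrite -[in LHS](lfun_injK (eb_inj s) y) [eb s y in LHS]sum_basis lincombE.
  rewrite !linear_sum; apply: eq_bigr => u _; rewrite !linearZ /=.
  have [->|yu] := eqVneq (eb s y u) 0; first by rewrite !scale0r.
  have us : b u <=p s by move/gensP: (eb_gens s y); apply.
  congr (_ *: _); rewrite /X -(ea_nat _ _ us) hom_nat; congr (ea s (phi s _)).
  apply/eqP; rewrite -subr_eq0; apply/eqP/(eb_inj s).
  by rewrite linearB /= eb_nat !ebVK ?subrr // basis_gens.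
have [N [q sqN]] := sq_ex (gens_mono k a) (rels_mono b X) (rels_sub Xg).
have [qS qK qN] := sqN.
have pi_nat s t (st : s <=p t) y :
    pm_map N st ((q s \o ea s)%VF y) =
    (q t \o ea t)%VF (pm_map (free_mod k a) st y).
  by rewrite !comp_lfunE ea_nat (qN _ _ st).
have phi_rho : is_cokernel phi (hom_of pi_nat).
  apply: pointwise_cokernel => s x.
    have [v /ea_surj[y <-] <-] := qS s x.
    by exists y; rewrite /= comp_lfunE.
  rewrite [hom_of pi_nat s]/= comp_lfunE; split=> [/eqP|[y <-]]; last first.
    by rewrite Xphi; apply/eqP; rewrite qK ?memv_img // -Xphi.
  rewrite qK // => /memv_imgP[_ /eb_surj[y <-] xy].
  exists y; apply/eqP; rewrite -subr_eq0; apply/eqP/(ea_inj s).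
  by rewrite linearB /= Xphi xy subrr.
have [q' sqM] := sq_iso sqN (cokernel_iso phi_rho phipi).
by exists T, U, a, b, X, q'.
Qed.

End Presentations.

(** * Idempotents and direct sums *)

Section Splittings.
Variables (k : fieldType) (R : realType) (n : nat).
Implicit Types (M N X : pmod k R n) (s t : Rn R n).

(** The summand is the pointwise image of [e], stable under the structure maps by naturality. *)
Lemma idem_split M (e : pmhom M M) : (forall s x, e s (e s x) = e s x) ->
  exists N (i : pmhom N M) (p : pmhom M N),
    (forall s x, p s (i s x) = x) /\ (forall s x, i s (p s x) = e s x).
Proof.
move=> ee; pose D s := limg (e s).
have De s x : e s x \in D s by apply: memv_img (memvf x).
have De_id s x : x \in D s -> e s x = x by move=> /memv_imgP[y _ ->].
have DN s t (st : s <=p t) x : x \in D s -> pm_map M st x \in D t.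
  by move=> /De_id <-; rewrite hom_nat.
pose f s t (st : s <=p t) : 'Hom(subvs_of (D s), subvs_of (D t)) :=
  (linfun (vsproj (D t)) \o (pm_map M st \o linfun vsval))%VF.
have fE s t (st : s <=p t) x : vsval (f s t st x) = pm_map M st (vsval x).
  by rewrite !comp_lfunE lfunE /= vsprojK ?lfunE // DN // subvsP.
have f_id s : f s s (lexx s) = \1%VF.
  by apply/lfunP => x; apply: subvs_inj; rewrite fE pm_map_id_at id_lfunE.
have f_comp s t u (st : s <=p t) (tu : t <=p u) :
    (f t u tu \o f s t st)%VF = f s u (le_trans st tu).
  apply/lfunP => x; apply: subvs_inj.
  by rewrite comp_lfunE !fE (pm_map_comp_at _ _ (le_trans st tu)).
pose N := @PMod k R n (fun s => subvs_of (D s)) f f_id f_comp.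
pose i s : 'Hom(N s, M s) := linfun vsval.
have iE s x : i s x = vsval x by rewrite lfunE.
pose p s : 'Hom(M s, N s) := (linfun (vsproj (D s)) \o e s)%VF.
have pE s x : vsval (p s x) = e s x by rewrite comp_lfunE lfunE /= vsprojK ?De.
have i_nat s t (st : s <=p t) x : pm_map M st (i s x) = i t (pm_map N st x).
  by rewrite !iE fE.
have p_nat s t (st : s <=p t) x : pm_map N st (p s x) = p t (pm_map M st x).
  by apply: subvs_inj; rewrite fE !pE hom_nat.
exists N, (hom_of i_nat), (hom_of p_nat); split=> s x /=.
  by apply: subvs_inj; rewrite pE iE De_id // subvsP.
by rewrite iE pE.
Qed.

Fact hom_compl_nat M (e : pmhom M M) s t (st : s <=p t) x :
  pm_map M st ((\1 - e s)%VF x) = (\1 - e t)%VF (pm_map M st x).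
Proof. by rewrite !add_lfunE !opp_lfunE !id_lfunE linearB /= hom_nat. Qed.

Definition hom_compl M (e : pmhom M M) : pmhom M M := hom_of (hom_compl_nat e).

Lemma hom_complE M (e : pmhom M M) s x : hom_compl e s x = x - e s x.
Proof. by rewrite /hom_compl /= add_lfunE opp_lfunE id_lfunE. Qed.

(** The images of [e] and of its complement are the two terms of a decomposition of [M], so one of
    them is zero. *)
Lemma idem_trivial M (e : pmhom M M) : ~ decomposable M ->
  (forall s x, e s (e s x) = e s x) ->
  (forall s x, e s x = 0) \/ (forall s x, e s x = x).
Proof.
move=> Mind ee; have [A [i [p [pi ip]]]] := idem_split ee.
pose e' := hom_compl e; have e'E s x : e' s x = x - e s x := hom_complE e x.
have [|B [j [q [qj jq]]]] := @idem_split M e'.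
  by move=> s x; rewrite !e'E linearB /= ee subrr subr0.
have [A0|An0] := pselect (pm_is_zero A).
  by left=> s x; rewrite -ip (A0 s (p s x)) linear0.
have [B0|Bn0] := pselect (pm_is_zero B).
  right=> s x; apply/esym/eqP; rewrite -subr_eq0 -e'E.
  by rewrite -jq (B0 s (q s x)) linear0.
have pe s x : p s (e s x) = p s x by rewrite -ip pi.
have pj s x : p s (j s x) = 0.
  have -> : j s x = e' s (j s x) by rewrite -jq qj.
  by rewrite e'E linearB /= pe subrr.
have qi s x : q s (i s x) = 0.
  by rewrite -[LHS]qj jq e'E -ip pi subrr linear0.
exfalso; apply: Mind; exists A, B; split=> //.
have f_lin s : linear (fun x : M s => (p s x, q s x)).
  by move=> c x y; rewrite !linearP.
have g_lin s : linear (fun y : pm_sum A B s => i s y.1 + j s y.2).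
  by move=> c x y; rewrite !linearP addrACA scalerDr.
pose f s : 'Hom(M s, pm_sum A B s) := projT1 (lfun_of (f_lin s)).
pose g s : 'Hom(pm_sum A B s, M s) := projT1 (lfun_of (g_lin s)).
have fE s x : f s x = (p s x, q s x) by apply: (projT2 (lfun_of (f_lin s))).
have gE s y : g s y = i s y.1 + j s y.2 by apply: (projT2 (lfun_of (g_lin s))).
have f_nat s t (st : s <=p t) x :
    pm_map (pm_sum A B) st (f s x) = f t (pm_map M st x).
  by rewrite !fE pair_lfunE /= !hom_nat.
have g_nat s t (st : s <=p t) y :
    pm_map M st (g s y) = g t (pm_map (pm_sum A B) st y).
  by rewrite !gE pair_lfunE /= linearD /= !hom_nat.
apply: (@pm_isoI _ _ _ _ _ (hom_of f_nat) (hom_of g_nat)) => s x.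
  by rewrite /= fE gE /= ip jq e'E addrC subrK.
by case: x => x y; rewrite /= gE fE /= !linearD /= pi qj pj qi addr0 add0r.
Qed.

Lemma decomposable_split M : decomposable M ->
  exists (A B : pmod k R n) (i : pmhom A M) (p : pmhom M A)
      (j : pmhom B M) (q : pmhom M B),
    [/\ ~ pm_is_zero A /\ ~ pm_is_zero B,
        forall s x, p s (i s x) = x, forall s x, q s (j s x) = x,
        (forall s x, p s (j s x) = 0) /\ (forall s x, q s (i s x) = 0)
      & forall s x, i s (p s x) + j s (q s x) = x].
Proof.
move=> [A [B [A0 B0 /pm_isoE[f [g [gf fg]]]]]].
have i_lin s : linear (fun x : A s => g s (x, 0)).
  by move=> c x y; rewrite -linearP /=; congr (g s _); congr pair;
    rewrite /= ?scaler0 ?addr0.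
have j_lin s : linear (fun y : B s => g s (0, y)).
  by move=> c x y; rewrite -linearP /=; congr (g s _); congr pair;
    rewrite /= ?scaler0 ?addr0.
have p_lin s : linear (fun x : M s => (f s x).1) by move=> c x y; rewrite linearP.
have q_lin s : linear (fun x : M s => (f s x).2) by move=> c x y; rewrite linearP.
pose i s : 'Hom(A s, M s) := projT1 (lfun_of (i_lin s)).
pose j s : 'Hom(B s, M s) := projT1 (lfun_of (j_lin s)).
pose p s : 'Hom(M s, A s) := projT1 (lfun_of (p_lin s)).
pose q s : 'Hom(M s, B s) := projT1 (lfun_of (q_lin s)).
have iE s x : i s x = g s (x, 0) by apply: (projT2 (lfun_of (i_lin s))).
have jE s x : j s x = g s (0, x) by apply: (projT2 (lfun_of (j_lin s))).
have pE s x : p s x = (f s x).1 by apply: (projT2 (lfun_of (p_lin s))).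
have qE s x : q s x = (f s x).2 by apply: (projT2 (lfun_of (q_lin s))).
have i_nat s t (st : s <=p t) x : pm_map M st (i s x) = i t (pm_map A st x).
  by rewrite !iE hom_nat pair_lfunE /= linear0.
have j_nat s t (st : s <=p t) x : pm_map M st (j s x) = j t (pm_map B st x).
  by rewrite !jE hom_nat pair_lfunE /= linear0.
have p_nat s t (st : s <=p t) x : pm_map A st (p s x) = p t (pm_map M st x).
  by rewrite !pE -hom_nat pair_lfunE.
have q_nat s t (st : s <=p t) x : pm_map B st (q s x) = q t (pm_map M st x).
  by rewrite !qE -hom_nat pair_lfunE.
exists A, B, (hom_of i_nat), (hom_of p_nat), (hom_of j_nat), (hom_of q_nat).
split=> //= [s x|s x||s x]; rewrite ?pE ?qE ?iE ?jE ?fg //.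
  by split=> s x; rewrite ?pE ?qE ?iE ?jE ?fg.
rewrite -linearD /= -[RHS]gf; congr (g s _).
by case: (f s x) => u v; congr pair; rewrite /= ?addr0 ?add0r.
Qed.

(** Joint injectivity of the projections replaces the formula expressing [x] as the sum of its
    components, so that [J] may be infinite. *)
Definition direct_split (J : eqType) (Mj : J -> pmod k R n) M
    (i : forall j, pmhom (Mj j) M) (p : forall j, pmhom M (Mj j)) :=
  [/\ forall j s x, p j s (i j s x) = x,
      forall j j' s x, j != j' -> p j' s (i j s x) = 0
    & forall s x, (forall j, p j s x = 0) -> x = 0].

Lemma direct_split_sum (J : finType) (Mj : J -> pmod k R n) M
    (i : forall j, pmhom (Mj j) M) (p : forall j, pmhom M (Mj j)) :
  direct_split i p -> forall s x, \sum_j i j s (p j s x) = x.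
Proof.
move=> [pi pi0 p0] s x; apply/esym/eqP; rewrite -subr_eq0; apply/eqP/p0 => j.
rewrite linearB linear_sum /= (bigD1 j) //= pi big1 ?addr0 ?subrr // => j' jj'.
exact: pi0.
Qed.

Lemma split_direct_sum (J : finType) (Mj : J -> pmod k R n) M
    (i : forall j, pmhom (Mj j) M) (p : forall j, pmhom M (Mj j)) :
  direct_split i p -> is_direct_sum Mj M.
Proof.
move=> ds; have [pi pi0 p0] := ds; exists i => s x.
have fs (v : forall j, Mj j s) :
    \sum_(j \in [set: J]) i j s (v j) = \sum_j i j s (v j).
  have -> : [set: J] = [set` index_enum J].
    by apply/seteqP; split=> j //= _; rewrite mem_index_enum.
  by rewrite -fsbig_seq ?index_enum_uniq.
exists (fun j => p j s x); split.
  by split; [exact: finite_finset | rewrite fs direct_split_sum].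
move=> v [_]; rewrite fs => xE; apply: functional_extensionality_dep => j.
rewrite xE linear_sum (bigD1 j) //= pi big1 ?addr0 // => j' jj'.
exact: pi0.
Qed.

(** The projections are the coordinates of the unique finitely supported family; uniqueness makes
    them linear and natural. *)
Lemma direct_sum_split (J : choiceType) (Mj : J -> pmod k R n) M :
  is_direct_sum Mj M ->
  exists (i : forall j, pmhom (Mj j) M) (p : forall j, pmhom M (Mj j)),
    direct_split i p.
Proof.
move=> [i iU].
pose good s (x : M s) (v : forall j, Mj j s) :=
  (finite_set [set j | v j != 0] /\ x = \sum_(j \in [set: J]) i j s (v j))%type.
pose c s x := projT1 (cid (iU s x)).
have cgood s x : good s x (c s x) by case: (projT2 (cid (iU s x))).
have cU s x v : good s x v -> c s x = v by case: (projT2 (cid (iU s x))) => _; apply.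
have fsE s (v : forall j, Mj j s) (D : {fset J}) :
    (forall j, j \notin D -> v j = 0) ->
    \sum_(j \in [set: J]) i j s (v j) = \sum_(j <- D) i j s (v j).
  by move=> vD; rewrite (fsbigTE D) // => j /vD ->; rewrite linear0.
have supp s (v : forall j, Mj j s) : finite_set [set j | v j != 0] ->
    exists D : {fset J}, forall j, j \notin D -> v j = 0.
  move=> fv; exists (fset_set [set j | v j != 0]) => j.
  by rewrite in_fset_set // notin_setE /= => /negP/negPn/eqP.
have goodI s x v (D : {fset J}) : (forall j, j \notin D -> v j = 0) ->
    x = \sum_(j <- D) i j s (v j) -> good s x v.
  move=> vD xE; split; last by rewrite (fsE _ _ D).
  apply: (@sub_finite_set _ _ [set` D]) => [j /= vj|]; last exact: finite_fset.
  by apply: contraNT vj => /vD ->.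
have p_lin j s : linear (fun x => c s x j).
  move=> a x y; have [fx xE] := cgood s x; have [fy yE] := cgood s y.
  have [D1 D1E] := supp _ _ fx; have [D2 D2E] := supp _ _ fy.
  have z1 (D := (D1 `|` D2)%fset) j' : j' \notin D -> c s x j' = 0.
    by rewrite in_fsetU negb_or => /andP[/D1E].
  have z2 (D := (D1 `|` D2)%fset) j' : j' \notin D -> c s y j' = 0.
    by rewrite in_fsetU negb_or => /andP[_ /D2E].
  rewrite (cU _ _ (fun j => a *: c s x j + c s y j)) //.
  apply: (goodI _ _ _ (D1 `|` D2)%fset) => [j' jD|].
    by rewrite z1 // z2 // scaler0 addr0.
  rewrite {1}xE {1}yE (fsE _ _ _ z1) (fsE _ _ _ z2) scaler_sumr -big_split /=.
  by apply: eq_bigr => j' _; rewrite linearP.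
pose p j s : 'Hom(M s, Mj j s) := projT1 (lfun_of (@p_lin j s)).
have pE j s x : p j s x = c s x j by apply: (projT2 (lfun_of (@p_lin j s))).
have p_nat j s t (st : s <=p t) x :
    pm_map (Mj j) st (p j s x) = p j t (pm_map M st x).
  rewrite !pE; have [fx xE] := cgood s x; have [D DE] := supp _ _ fx.
  rewrite (cU _ _ (fun j => pm_map (Mj j) st (c s x j))) //.
  apply: (goodI _ _ _ D) => [j' /DE ->|]; first by rewrite linear0.
  rewrite {1}xE (fsE _ _ _ DE) linear_sum; apply: eq_bigr => j' _.
  exact: hom_nat.
exists i, (fun j => hom_of (@p_nat j)).
(* The coordinates of an element of one summand are concentrated at [j]; the cast is needed since
   the type of a coordinate depends on its index. *)
have cE s j x : c s (i j s x) = fun j' => if j' =P j is ReflectT e then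
    ecast l (Mj l s) (esym e) x else 0.
  apply: cU; apply: (goodI _ _ _ [fset j]%fset) => [j'|].
    by rewrite in_fset1; case: (j' =P j).
  rewrite big_seq_fset1; case: (j =P j) => // e.
  by rewrite (eq_irrelevance e erefl).
split=> [j s x|j j' s x jj'|s x px0] /=.
- by rewrite pE cE; case: (j =P j) => // e; rewrite (eq_irrelevance e erefl).
- by rewrite pE cE; case: (j' =P j) => // e; rewrite e eqxx in jj'.
have [fx xE] := cgood s x; rewrite xE (fsE _ _ fset0) ?big_seq_fset0 // => j _.
by rewrite -pE px0.
Qed.

End Splittings.

(** * Degrees, decompositions and interleavings *)

Section Posets.
Variables (R : realType) (n : nat).
Implicit Types s t : Rn R n.

Lemma pleP s t : reflect (forall i, s i <= t i) (s <=p t).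
Proof. exact: asboolP. Qed.

Lemma le_pshift s e : 0 <= e -> s <=p pshift s e.
Proof. by move=> e0; apply/pleP => i; rewrite lerDl. Qed.

Lemma pshift_mono s e e' : e <= e' -> pshift s e <=p pshift s e'.
Proof. by move=> ee; apply/pleP => i; rewrite lerD2l. Qed.

Lemma le_pshift2 s e : 0 <= e -> s <=p pshift (pshift s e) e.
Proof. by move=> e0; apply: le_trans (le_pshift _ e0) (le_pshift _ e0). Qed.

(** If [p j] is not below [p i], some coordinate violates the inequality, and half of its excess is
    a shift that does not repair it. The minimum over the finitely many pairs works for all of
    them. *)
Lemma pshift_gap (I : finType) (p : I -> Rn R n) :
  exists2 g, 0 < g & forall i j, p j <=p pshift (p i) g -> p j <=p p i.
Proof.
have gapij (ij : I * I) :
    {g | 0 < g & p ij.2 <=p pshift (p ij.1) g -> p ij.2 <=p p ij.1}.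
  apply: cid2; case: ij => i j /=.
  have [pji|/pleP npji] := boolP (p j <=p p i); first by exists 1.
  have /existsNP[c /negP] := npji; rewrite -ltNge => pc.
  exists ((p j c - p i c) / 2) => [|/pleP/(_ c)]; first by rewrite /=; lra.
  by rewrite /pshift; lra.
pose f ij := s2val (gapij ij).
have f0 ij : 0 < f ij by apply: (s2valP (gapij ij)).
exists (\big[Order.min/1]_ij f ij) => [|i j pij].
  by elim/big_ind: _ => // x y x0 y0; rewrite lt_min x0.
apply: (s2valP' (gapij (i, j))); apply: le_trans pij _.
by apply: pshift_mono; apply: (@bigmin_le _ _ _ 1 (i, j)).
Qed.

End Posets.

(** * Finite decompositions into summands that are not decomposable *)

Section Finiteness.
Variables (k : fieldType) (R : realType) (n : nat).
Implicit Types (M N X : pmod k R n) (s t : Rn R n).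

(** Generation is tested on morphisms out of [M], a form that passes to direct summands at once. *)
Definition generated_at (T : finType) (a : T -> Rn R n) M :=
  forall X (u : pmhom M X), (forall (t : T) x, u (a t) x = 0) -> forall s x, u s x = 0.

Lemma generated_at_summand (T : finType) (a : T -> Rn R n) M A
    (i : pmhom A M) (p : pmhom M A) :
  (forall s x, p s (i s x) = x) -> generated_at a M -> generated_at a A.
Proof.
move=> pi Mg X u u0 s x.
rewrite -[x]pi -hom_compE; apply: Mg => t y.
by rewrite hom_compE u0.
Qed.

Lemma generated_at_neq0 (T : finType) (a : T -> Rn R n) M :
  generated_at a M -> ~ pm_is_zero M -> exists t : T, (0 < \dim {: M (a t)})%N.
Proof.
move=> Mg Mn0; apply: contrapT => nM; apply: Mn0 => s x.
rewrite -[LHS]hom_idE; apply: Mg => t y; rewrite hom_idE.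
apply: contrapT => /eqP y0; apply: nM; exists t.
rewrite lt0n dimv_eq0; apply: contraNneq y0 => M0.
by rewrite -memv0 -M0 memvf.
Qed.

(** Induction on the total dimension of [M] at the degrees [a t]. It drops at each splitting because
    a nonzero summand is nonzero at one of these degrees. *)
Lemma split_indecomposable M (T : finType) (a : T -> Rn R n) :
  generated_at a M ->
  exists (J : finType) (Mj : J -> pmod k R n)
      (i : forall j, pmhom (Mj j) M) (p : forall j, pmhom M (Mj j)),
    direct_split i p /\ forall j, ~ decomposable (Mj j).
Proof.
pose mu M := (\sum_t \dim {: pm_obj M (a t)})%N.
have [m] := ubnP (mu M); elim: m M => // m IH M muM Mg.
have [Md|Mnd] := pselect (decomposable M); last first.
  exists unit, (fun=> M), (fun=> hom_id M), (fun=> hom_id M); split=> //.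
  split=> [j s x|[] [] //|s x /(_ tt)]; rewrite !hom_idE //.
(* Rank-nullity for [q], whose kernel contains the image of [A], bounds the sum of the two
   dimensions at every degree. *)
have mu_lt A B (i : pmhom A M) (p : pmhom M A) (j : pmhom B M) (q : pmhom M B) :
    (forall s x, p s (i s x) = x) -> (forall s x, q s (j s x) = x) ->
    (forall s x, q s (i s x) = 0) -> ~ pm_is_zero B -> (mu A < m)%N.
  move=> pi qj qi B0; apply: leq_trans (_ : mu M <= m)%N => //.
  have kerQ s : (limg (i s) <= lker (q s))%VS.
    by apply/subvP => _ /memv_imgP[x _ ->]; rewrite memv_ker qi.
  have dimA s : \dim (limg (i s)) = \dim {: A s}.
    apply: limg_dim_eq; apply/eqP; rewrite capfv; apply/lker0P => x y ixy.
    by rewrite -[x]pi ixy pi.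
  have dimB s : \dim (limg (q s)) = \dim {: B s}.
    congr (\dim _); apply/vspaceP => x; rewrite memvf -[x]qj.
    by rewrite memv_img ?memvf.
  have dims s : (\dim {: A s} + \dim {: B s} <= \dim {: M s})%N.
    rewrite -(limg_ker_dim (q s) {: M s}) dimB leq_add2r capfv.
    by rewrite -dimA dimvS.
  have [t Bt] := generated_at_neq0 (generated_at_summand qj Mg) B0.
  rewrite /mu (bigD1 t) //= [X in (_ < X)%N](bigD1 t) //= -addSn leq_add //.
    by apply: leq_trans (dims _); rewrite -addn1 leq_add2l.
  by apply: leq_sum => x _; apply: leq_trans (dims _); apply: leq_addr.
have [A [B [iA [pA [iB [pB [[A0 B0] piA piB [pAiB pBiA] iAB]]]]]]] :=
  decomposable_split Md.
have [J1 [N1 [i1 [p1 [[pi1 pi1_0 p1_0] N1_nd]]]]] :=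
  IH A (mu_lt _ _ _ _ _ _ piA piB pBiA B0) (generated_at_summand piA Mg).
have [J2 [N2 [i2 [p2 [[pi2 pi2_0 p2_0] N2_nd]]]]] :=
  IH B (mu_lt _ _ _ _ _ _ piB piA pAiB A0) (generated_at_summand piB Mg).
pose Nj (j : J1 + J2) := match j with inl j1 => N1 j1 | inr j2 => N2 j2 end.
pose i (j : J1 + J2) : pmhom (Nj j) M :=
  match j with
  | inl j1 => hom_comp iA (i1 j1) | inr j2 => hom_comp iB (i2 j2)
  end.
pose p (j : J1 + J2) : pmhom M (Nj j) :=
  match j with
  | inl j1 => hom_comp (p1 j1) pA | inr j2 => hom_comp (p2 j2) pB
  end.
exists (J1 + J2)%type, Nj, i, p; split; last by case.
split=> [[j|j] s x|[j|j] [j'|j'] s x jj'|s x px]; rewrite /i /p ?hom_compE.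
- by rewrite piA pi1.
- by rewrite piB pi2.
- by rewrite piA pi1_0.
- by rewrite pBiA linear0.
- by rewrite pAiB linear0.
- by rewrite piB pi2_0.
rewrite -[x]iAB (p1_0 _ (pA s x)) => [|j].
  rewrite (p2_0 _ (pB s x)) ?linear0 ?addr0 // => j.
  by have := px (inr j); rewrite /p hom_compE.
by have := px (inl j); rewrite /p hom_compE.
Qed.

End Finiteness.

(** * Interleavings and the two distances *)

Section Interleavings.
Variables (k : fieldType) (R : realType) (n : nat).
Implicit Types (M N X : pmod k R n) (s t : Rn R n).

Lemma hom_nat1 M N e (f : pmhom M (pm_shift N e)) s t (st : s <=p t)
    (st' : pshift s e <=p pshift t e) x :
  pm_map N st' (f s x) = f t (pm_map M st x).
Proof. by rewrite -(hom_nat f); apply: pm_map_irr. Qed.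

Lemma hom_nat2 M N e (f : pmhom M (pm_shift (pm_shift N e) e)) s t (st : s <=p t)
    (st' : pshift (pshift s e) e <=p pshift (pshift t e) e) x :
  pm_map N st' (f s x) = f t (pm_map M st x).
Proof. by rewrite -(hom_nat f); apply: pm_map_irr. Qed.

Lemma interleavedP e M N : 0 <= e -> interleaved e M N <->
  exists (f : pmhom M (pm_shift N e)) (g : pmhom N (pm_shift M e)),
    (forall s (h : s <=p pshift (pshift s e) e) x,
       g (pshift s e) (f s x) = pm_map M h x) /\
    (forall s (h : s <=p pshift (pshift s e) e) x,
       f (pshift s e) (g s x) = pm_map N h x).
Proof.
move=> e0; split=> [[_ [f [g fg]]]|[f [g [gf fg]]]].
  exists f, g; split=> s h x; rewrite -comp_lfunE; last by rewrite (fg s h).2.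
  by rewrite (fg s h).1.
split=> //; exists f, g => s h; split; apply/lfunP => x; rewrite comp_lfunE.
  exact: gf.
exact: fg.
Qed.

Lemma interleaved_mono e e' M N : e <= e' -> interleaved e M N ->
  interleaved e' M N.
Proof.
move=> ee ef; have e0 := ef.1; have e'0 := le_trans e0 ee.
move/(interleavedP _ _ e0): ef => [f [g [gf fg]]].
pose up s := pshift_mono s ee.
have f_nat s t (st : s <=p t) x :
    pm_map (pm_shift N e') st ((pm_map N (up s) \o f s)%VF x) =
    (pm_map N (up t) \o f t)%VF (pm_map M st x).
  by rewrite !comp_lfunE -(hom_nat f) /= !pm_mapM; apply: pm_map_irr.
have g_nat s t (st : s <=p t) x :
    pm_map (pm_shift M e') st ((pm_map M (up s) \o g s)%VF x) =
    (pm_map M (up t) \o g t)%VF (pm_map N st x).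
  by rewrite !comp_lfunE -(hom_nat g) /= !pm_mapM; apply: pm_map_irr.
apply/interleavedP => //; exists (hom_of f_nat), (hom_of g_nat).
split=> s h x /=; rewrite !comp_lfunE.
  by rewrite -(hom_nat g) (gf s (le_pshift2 s e0)) !pm_mapM; apply: pm_map_irr.
by rewrite -(hom_nat f) (fg s (le_pshift2 s e0)) !pm_mapM; apply: pm_map_irr.
Qed.

(** By [interleaved_zeroP], this is being [e]-interleaved with a zero module. *)
Definition eta_zero e M :=
  forall s (h : s <=p pshift (pshift s e) e) x, pm_map M h x = 0.

Fact hom0_nat M N s t (st : s <=p t) x :
  pm_map N st ((0 : 'Hom(M s, N s)) x) = (0 : 'Hom(M t, N t)) (pm_map M st x).
Proof. by rewrite !zero_lfunE linear0. Qed.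

Definition hom0 M N : pmhom M N := hom_of (@hom0_nat M N).

Lemma hom0E M N s x : hom0 M N s x = 0.
Proof. exact: zero_lfunE. Qed.

Lemma interleaved_zeroP e M N : 0 <= e -> pm_is_zero M ->
  interleaved e M N <-> eta_zero e N.
Proof.
move=> e0 M0; rewrite interleavedP //; split=> [[f [g [_ fg]]] s h x|N0].
  by rewrite -fg (M0 _ (g s x)) linear0.
exists (hom0 M (pm_shift N e)), (hom0 N (pm_shift M e)); split=> s h x.
  by rewrite (M0 s x) !linear0.
by rewrite N0 !hom0E.
Qed.

Lemma interleaved_sym e M N : interleaved e M N -> interleaved e N M.
Proof. by move=> [e0 [f [g fg]]]; split=> //; exists g, f => s h; have [] := fg s h. Qed.

Lemma interleaved_dI e M N : interleaved e M N -> (dI M N <= e%:E)%E.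
Proof. by move=> ef; apply: ereal_inf_lbound; exists e. Qed.

Lemma dI_interleaved d M N : (dI M N < d%:E)%E ->
  exists2 e, e < d & interleaved e M N.
Proof. by move=> /ereal_inf_lt[_ [e ef <-]]; rewrite lte_fin; exists e. Qed.

Lemma matching_dB e M N : matching e M N -> (dB M N <= e%:E)%E.
Proof. by move=> ef; apply: ereal_inf_lbound; exists e. Qed.

Lemma dB_matching d M N : (dB M N < d%:E)%E ->
  exists2 e, e < d & matching e M N.
Proof. by move=> /ereal_inf_lt[_ [e ef <-]]; rewrite lte_fin; exists e. Qed.

End Interleavings.

(** * Rigidity of a presented module under small shifts *)

Section Presented.
Variables (k : fieldType) (R : realType) (n : nat) (T U : finType).
Variables (a : T -> Rn R n) (b : U -> Rn R n) (X : U -> {ffun T -> k^o}).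
Variables (M : pmod k R n) (q : forall s, 'Hom({ffun T -> k^o}, M s)).
Hypothesis X_gens : forall u, X u \in gens k a (b u).
Hypothesis sqM : subquot (gens k a) (rels b X) q.
Local Notation A := (gens k a).
Local Notation B := (rels b X).

Lemma pres_ext N (u v : pmhom M N) :
  (forall t, u (a t) (q (a t) (basis_vec k t)) = v (a t) (q (a t) (basis_vec k t))) ->
  forall s x, u s x = v s x.
Proof.
move=> uv s x; have [w /gensP ws <-] := sq_surj sqM x.
rewrite (lfun_basis (q s)) !linear_sum; apply: eq_bigr => t _; rewrite !linearZ /=.
have [->|/ws ts] := eqVneq (w t) 0; first by rewrite !scale0r.
by rewrite -(sq_nat sqM ts) ?basis_gens // -!hom_nat uv.
Qed.

Lemma pres_generated : generated_at a M.
Proof.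
move=> N u u0 s x; rewrite -(hom0E N x); apply: pres_ext => t.
by rewrite u0 hom0E.
Qed.

(** Generators and relations share one index type, so that one gap [g] separates all their degrees
    at once. *)
Definition degree (i : T + U) : Rn R n :=
  match i with inl t => a t | inr u => b u end.

Variable g : R.
Hypothesis gap : forall i j,
  degree j <=p pshift (degree i) g -> degree j <=p degree i.

(** A generator present at [s] has degree at most [degree i] shifted by [g], hence at most
    [degree i] by the gap. Relations behave alike in [rels_gap]. *)
Lemma gens_gap i s : s <=p pshift (degree i) g -> (A s <= A (degree i))%VS.
Proof.
move=> si; apply/subvP => v /gensP vs; apply/gensP => t /vs ts.
by apply: (gap (j := inl t)); apply: le_trans ts si.
Qed.

Lemma rels_gap i s : s <=p pshift (degree i) g -> (B s <= B (degree i))%VS.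
Proof.
move=> si; apply: rels_ind => u us; apply: rels_basis.
by apply: (gap (j := inr u)); apply: le_trans us si.
Qed.

(** An element can only die through a relation, and none appears between [degree i] and its shift by
    [g]. *)
Lemma degree_inj i s (is_ : degree i <=p s) x : s <=p pshift (degree i) g ->
  pm_map M is_ x = 0 -> x = 0.
Proof.
move=> si; have [v vA <-] := sq_surj sqM x.
rewrite (sq_nat sqM is_ vA) => /eqP.
rewrite (sq_ker sqM) ?(subvP (gens_mono k a is_)) // => vB.
by apply/eqP; rewrite (sq_ker sqM) // (subvP (rels_gap si)).
Qed.

(** It suffices to kill [i] on the projected generators. At [a t] the structure map of [M] to the
    shift by [2e] is injective, while on the summand it vanishes. *)
Lemma summand_zero N (i : pmhom N M) (p : pmhom M N) e :
  (forall s x, p s (i s x) = x) -> 0 <= e -> e + e <= g -> eta_zero e N ->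
  pm_is_zero N.
Proof.
move=> pi e0 eg N0 s x; rewrite -[x]pi -(hom0E N (i s x)).
apply: pres_ext => t; rewrite hom0E; set y := q _ _.
have h := le_pshift2 (a t) e0.
suff : i (a t) (p (a t) y) = 0 by move=> iy; rewrite -[LHS]pi iy linear0.
apply: (@degree_inj (inl t) _ h).
  by apply/pleP => c; rewrite /pshift -addrA lerD2l.
by rewrite hom_nat N0 linear0.
Qed.

(** The shift by [2e] changes neither [A] nor [B] at the degrees of the presentation. Hence the
    images of the generators have representatives already at [a t], and the lifted map respects each
    relation already at [b u]. *)
Lemma lift_endo e (psi : pmhom M (pm_shift (pm_shift M e) e)) :
  0 <= e -> e + e <= g ->
  exists phi : pmhom M M,
    forall s (h : s <=p pshift (pshift s e) e) x, pm_map M h (phi s x) = psi s x.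
Proof.
move=> e0 eg; pose sh (s : Rn R n) := pshift (pshift s e) e.
have sh_le (i : T + U) : sh (degree i) <=p pshift (degree i) g.
  by apply/pleP => c; rewrite /sh /pshift -addrA lerD2l.
have shst s t : s <=p t -> sh s <=p sh t.
  by move=> st; do 2!apply: pshift_le.
have exl (t : T) : exists v, v \in A (a t) /\
    q (sh (a t)) v = psi (a t) (q (a t) (basis_vec k t)).
  have [v vA vE] := sq_surj sqM (psi (a t) (q (a t) (basis_vec k t))).
  by exists v; split=> //; apply: (subvP (gens_gap (sh_le (inl t)))).
have [l lE] := choice exl; pose L := lincomb l.
have LA s v : v \in A s -> L v \in A s.
  move=> /gensP vs; rewrite /L lincombE; apply: rpred_sum => t _.
  have [->|/vs ts] := eqVneq (v t) 0; first by rewrite scale0r rpred0.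
  by apply: rpredZ; apply: (subvP (gens_mono k a ts)); case: (lE t).
have qL s v : v \in A s -> q (sh s) (L v) = psi s (q s v).
  move=> /gensP vs; rewrite /L lincombE (lfun_basis (q s)) !linear_sum.
  apply: eq_bigr => t _; rewrite !linearZ /=.
  have [->|/vs ts] := eqVneq (v t) 0; first by rewrite !scale0r.
  have [lt1 lt2] := lE t.
  rewrite -(sq_nat sqM ts) ?basis_gens // -(hom_nat2 psi ts (shst _ _ ts)) -lt2.
  rewrite (sq_nat sqM (shst _ _ ts)) //.
  exact: (subvP (gens_mono k a (le_pshift2 (a t) e0))).
have LB u : L (X u) \in B (b u).
  apply: (subvP (rels_gap (sh_le (inr u)))) => /=.
  have LXA : L (X u) \in A (sh (b u)).
    by apply: (subvP (gens_mono k a (le_pshift2 (b u) e0))); apply: LA.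
  rewrite -(sq_ker sqM LXA) qL //.
  have /eqP -> : q (b u) (X u) == 0 by rewrite (sq_ker sqM) ?rels_basis.
  by rewrite linear0.
have [phi phiE] : exists phi : pmhom M M,
    forall s v, v \in A s -> phi s (q s v) = (q s \o L)%VF v.
  apply: (sq_desc (gens_mono k a) sqM) => [s v _ vB|s t st v vA].
    apply/eqP; rewrite -memv_ker; move: v vB; apply/subvP; apply: rels_ind => u us.
    rewrite memv_ker comp_lfunE (sq_ker sqM).
      by apply: (subvP (rels_mono b X us)); apply: LB.
    by apply: LA; apply: (subvP (gens_mono k a us)).
  by rewrite !comp_lfunE (sq_nat sqM) // LA.
exists phi => s h x; have [v vA <-] := sq_surj sqM x.
by rewrite phiE // comp_lfunE (sq_nat sqM) ?LA // qL.
Qed.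

(** Equality is checked on generators, where [degree_inj] cancels the structure map. The shift [sg]
    is left abstract because it is used for a fourfold iterated shift. *)
Lemma endo_eq (phi phi' : pmhom M M) (sg : Rn R n -> Rn R n)
    (sg_ge : forall s, s <=p sg s) :
  (forall i, sg (degree i) <=p pshift (degree i) g) ->
  (forall s x, pm_map M (sg_ge s) (phi s x) = pm_map M (sg_ge s) (phi' s x)) ->
  forall s x, phi s x = phi' s x.
Proof.
move=> sg_le pp; apply: pres_ext => t; apply/eqP; rewrite -subr_eq0; apply/eqP.
apply: (@degree_inj (inl t) _ (sg_ge _)); first exact: (sg_le (inl t)).
by rewrite linearB /= pp subrr.
Qed.

End Presented.

(** * Stability *)

Section Stability.
Variables (k : fieldType) (R : realType) (n : nat).
Implicit Types (M N : pmod k R n) (s t : Rn R n).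

Definition hom_shift M N (f : pmhom M N) e :
    pmhom (pm_shift M e) (pm_shift N e) :=
  @PMHom _ _ _ (pm_shift M e) (pm_shift N e) (fun s => f (pshift s e))
    (fun s t st => hom_natural f (pshift_le e st)).

Lemma direct_split_zero (J : finType) M : pm_is_zero M ->
  is_direct_sum (fun _ : J => pm0 k R n) M.
Proof.
move=> M0; apply: (@split_direct_sum _ _ _ J _ _ (fun=> hom0 _ M) (fun=> hom0 M _)).
split=> [j s x|j j' s x _|s x _]; last exact: M0.
  by rewrite hom0E [RHS]thinmx0.
by rewrite hom0E.
Qed.

Lemma direct_split_single (J : finType) (j0 : J) M :
  is_direct_sum (fun j : J => if j == j0 then M else pm0 k R n) M.
Proof.
(* The family depends on [j] only through a boolean; over booleans the dependent cases reduce. *)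
pose Mb (c : bool) := if c then M else pm0 k R n.
pose i (c : bool) : pmhom (Mb c) M :=
  match c return pmhom (Mb c) M with true => hom_id M | false => hom0 _ M end.
pose p (c : bool) : pmhom M (Mb c) :=
  match c return pmhom M (Mb c) with true => hom_id M | false => hom0 M _ end.
have pi0 c c' s x : ~~ (c && c') -> p c' s (i c s x) = 0.
  case: c x => x; last by rewrite [i _ s x]hom0E linear0.
  by case: c' => // _; apply: thinmx0.
apply: (@split_direct_sum _ _ _ J _ _ (fun j => i (j == j0)) (fun j => p (j == j0))).
split=> [j s x|j j' s x jj'|s x /(_ j0)].
- by case: (j == j0) x => x; [rewrite !hom_idE | rewrite [RHS]thinmx0; apply: thinmx0].
- apply: pi0; apply: contra jj' => /andP[/eqP -> /eqP ->].
  exact: eqxx.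
by rewrite eqxx hom_idE.
Qed.

Lemma zero_not_decomposable M : pm_is_zero M -> ~ decomposable M.
Proof.
move=> M0 /decomposable_split[A [B [i [p [_ [_ [[A0 _] pi _ _ _]]]]]]].
by apply: A0 => s x; rewrite -(pi s x) (M0 s (i s x)) linear0.
Qed.

Lemma nd_indecomposable_or_zero M : ~ decomposable M ->
  indecomposable M \/ pm_is_zero M.
Proof. by move=> Md; have [M0|M0] := pselect (pm_is_zero M); [right | left]. Qed.

Lemma pm0_zero : pm_is_zero (pm0 k R n).
Proof. by move=> s x; apply: thinmx0. Qed.

Section CloseMatching.
Variables (T U : finType).
Variables (a : T -> Rn R n) (b : U -> Rn R n) (X : U -> {ffun T -> k^o}).
Variables (M : pmod k R n) (q : forall s, 'Hom({ffun T -> k^o}, M s)).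
Hypothesis X_gens : forall u, X u \in gens k a (b u).
Hypothesis sqM : subquot (gens k a) (rels b X) q.
Variable g : R.
Hypothesis gap : forall i j,
  degree a b j <=p pshift (degree a b i) g -> degree a b j <=p degree a b i.

(** Identities between products of two lifted endomorphisms are compared after a shift by [4e],
    whence the bound by [g]. *)
Lemma close_matching (J : finType) (Nj : J -> pmod k R n) N
    (i : forall j, pmhom (Nj j) N) (p : forall j, pmhom N (Nj j)) e :
  0 <= e -> (e + e) + (e + e) <= g -> ~ decomposable M ->
  direct_split i p -> (forall j, ~ decomposable (Nj j)) ->
  interleaved e M N -> matching (e + e) M N.
Proof.
move=> e0 eg Md ds Nd MN; have [pi pi0 p0] := ds.
have e2 : 0 <= e + e by apply: addr_ge0.
have e2g : e + e <= g by apply: le_trans eg; rewrite lerDl.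
have /(interleavedP _ _ e0)[f [gg [gf fg]]] := MN.
pose psi j : pmhom M (pm_shift (pm_shift M e) e) :=
  hom_comp (hom_shift (hom_comp gg (hom_comp (i j) (p j))) e) f.
have psiE j s x : psi j s x = gg (pshift s e) (i j _ (p j _ (f s x))).
  by rewrite /psi hom_compE /= !comp_lfunE.
have [phi phiE] := choice (fun j => lift_endo X_gens sqM gap (psi j) e0 e2g).
have up s := le_pshift2 s e0.
have up2 s : s <=p pshift (pshift (pshift (pshift s e) e) e) e.
  exact: le_trans (up s) (up _).
have up2g c : pshift (pshift (pshift (pshift (degree a b c) e) e) e) e <=p
    pshift (degree a b c) g.
  by apply/pleP => l; rewrite /pshift -!addrA lerD2l addrA.
have phi2 j j' s x :
    pm_map M (up2 s) (phi j' s (phi j s x)) = psi j' _ (psi j s x).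
  rewrite -(pm_map_comp_at (up s) (up _)) (phiE j' s (up s)).
  by rewrite (hom_nat2 _ (up s)) phiE.
(* The middle composite of [gg] and [f] is a structure map of [N]; it moves past the projections,
   leaving [p j'] applied to [i j]. *)
have psi2 j j' s x : psi j' _ (psi j s x) =
    gg _ (pm_map N (up _) (i j' _ (p j' _ (i j _ (p j _ (f s x)))))).
  by rewrite !psiE fg -!hom_nat.
have psi_up j s x : pm_map M (up2 s) (phi j s x) =
    gg _ (pm_map N (up _) (i j _ (p j _ (f s x)))).
  rewrite -(pm_map_comp_at (up s) (up _)) (phiE j s (up s)) psiE.
  exact: hom_nat1.
have phi_idem j s x : phi j s (phi j s x) = phi j s x.
  rewrite -hom_compE; apply: (endo_eq sqM gap (sg_ge := up2) up2g) => {}s {}x.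
  by rewrite hom_compE phi2 psi2 pi psi_up.
have phi_orth j j' s x : j != j' -> phi j' s (phi j s x) = 0.
  move=> jj'; rewrite -hom_compE -(hom0E M x).
  apply: (endo_eq sqM gap (sg_ge := up2) up2g) => {}s {}x.
  by rewrite hom_compE phi2 psi2 hom0E pi0 // !linear0.
(* On [Nj j], the structure map by [2e] is [p f gg i]. Its square contains [gg i p f], which is
   [psi j] and vanishes with [phi j]. *)
have small j : (forall s x, phi j s x = 0) -> eta_zero (e + e) (Nj j).
  move=> phi0; have psi0 s x : psi j s x = 0 by rewrite -(phiE j s (up s)) phi0 linear0.
  have pfgi s (y : Nj j s) : p j _ (f _ (gg s (i j s y))) = pm_map (Nj j) (up s) y.
    by rewrite fg hom_nat pi.
  have N0 s (y : Nj j s) : pm_map (Nj j) (up2 s) y = 0.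
    rewrite -(pm_map_comp_at (up s) (up _)) -pfgi -(pfgi s y).
    have := psi0 _ (gg s (i j s y)); rewrite psiE => ->.
    by rewrite !linear0.
  move=> s h y.
  have h' : pshift (pshift (pshift (pshift s e) e) e) e <=p
      pshift (pshift s (e + e)) (e + e).
    by apply/pleP => c; rewrite /pshift -!addrA.
  by rewrite -(pm_map_comp_at (up2 s) h') N0 linear0.
have phi01 j := idem_trivial Md (phi_idem j).
have [M0|Mn0] := pselect (pm_is_zero M).
  split=> //; exists J, (fun _ => pm0 k R n), Nj.
  split=> [||j|j|j]; first exact: direct_split_zero.
  - exact: split_direct_sum ds.
  - by right; apply: pm0_zero.
  - exact: nd_indecomposable_or_zero.
  - by apply/(interleaved_zeroP _ e2 pm0_zero); apply: small => s x; apply: M0.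
(* The [psi j] add up to the composite of [f] and [gg], a structure map of [M]. If every [phi j]
   vanished, this map would be zero, and so would [M]. *)
have [j0 j0_id] : exists j, forall s x, phi j s x = x.
  apply: contrapT => no_id; apply: Mn0 => s x.
  have phi0 j t y : phi j t y = 0.
    case: (phi01 j) => // id_j; exfalso; apply: no_id; exists j; apply: id_j.
  rewrite -[LHS]hom_idE -(hom0E M x).
  apply: (endo_eq sqM gap (sg_ge := up2) up2g) => {}s {}x.
  rewrite hom_idE hom0E linear0 -(pm_map_comp_at (up s) (up _)) -(gf s).
  rewrite -[f s x](direct_split_sum ds) linear_sum /= big1 ?linear0 // => j _.
  by rewrite -psiE -(phiE j s (up s)) phi0 linear0.
split=> //; exists J, (fun j : J => if j == j0 then M else pm0 k R n), Nj.
split=> [||j|j|j]; first exact: direct_split_single.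
- exact: split_direct_sum ds.
- by case: (j == j0); apply: nd_indecomposable_or_zero; last
    apply: zero_not_decomposable pm0_zero.
- exact: nd_indecomposable_or_zero.
have [->|jj0] := eqVneq j j0; last first.
  apply/(interleaved_zeroP _ e2 pm0_zero); apply: small => s x.
  by rewrite -(j0_id s x) phi_orth // eq_sym.
apply: (interleaved_mono (_ : e <= e + e)); first by rewrite lerDl.
apply/(interleavedP _ _ e0).
(* As [phi j0] is the identity, [psi j0] is the structure map of [M], so [f] and [gg] cut down to
   [Nj j0] still interleave. *)
exists (hom_comp (hom_shift (p j0) e) f), (hom_comp gg (i j0)); split=> s h y.
  rewrite !hom_compE /= -psiE -(phiE j0 s h) j0_id //.
by rewrite !hom_compE /= fg hom_nat pi.
Qed.

End CloseMatching.

Lemma stable_of_not_decomposable M :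
  fin_presentable M -> ~ decomposable M -> structurally_stable M.
Proof.
move=> /pres_of_fp[T [U [a [b [X [q [Xg sqM]]]]]]] Md eps eps0.
have [g g0 gap] := pshift_gap (degree a b).
(* With [e] below both terms, [2e] is less than [eps] and [4e] is less than [g]. *)
exists (Num.min (eps / 2) (g / 4)) => [|N Nfp /dI_interleaved[e elt MN]].
  by rewrite lt_min !divr_gt0.
move: elt; rewrite lt_min => /andP[e_eps e_g]; have e0 := MN.1.
have [T' [U' [a' [b' [X' [q' [X'g sqN]]]]]]] := pres_of_fp Nfp.
have [J [Nj [i [p [ds Nd]]]]] := split_indecomposable (pres_generated sqN).
have Mm : matching (e + e) M N.
  by apply: (close_matching Xg sqM gap e0 _ Md ds Nd MN); lra.
by apply: le_lt_trans (matching_dB Mm) _; rewrite lte_fin; lra.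
Qed.

(** Each summand of [N] in a matching gives an idempotent of [N], hence is zero or all of [N].
    Summands of [M] matched with zero vanish by [summand_zero]. *)
Lemma indecomposable_or_zero_of_close M :
  fin_presentable M -> structurally_stable M ->
  (forall d, 0 < d -> exists N, [/\ fin_presentable N, interleaved d M N &
    forall e : pmhom N N, (forall s x, e s (e s x) = e s x) ->
      (forall s x, e s x = 0) \/ (forall s x, e s x = x)]) ->
  indecomposable M \/ pm_is_zero M.
Proof.
move=> /pres_of_fp[T [U [a [b [X [q [Xg sqM]]]]]]] Mst dense.
have [g g0 gap] := pshift_gap (degree a b).
(* A matching parameter below [g / 2] is what [summand_zero] requires. *)
have [d d0 Md] := Mst (g / 2) (divr_gt0 g0 (ltr0Sn _ _)).
have [N [Nfp MN Nid]] := dense (d / 2) (divr_gt0 d0 (ltr0Sn _ _)).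
have [|e e_g] := dB_matching (Md N Nfp _).
  by apply: le_lt_trans (interleaved_dI MN) _; rewrite lte_fin; lra.
move=> [e0 [J [Mj [Nj [MJ NJ Mj_ind _ MNj]]]]].
have [i [p [pi pi0 p0]]] := direct_sum_split MJ.
have [i' [p' [pi' pi0' p0']]] := direct_sum_split NJ.
have MjZ j : pm_is_zero (Nj j) -> pm_is_zero (Mj j).
  move=> Nj0; apply: (summand_zero sqM gap (pi j) e0); first by lra.
  by apply/(interleaved_zeroP _ e0 Nj0); apply/interleaved_sym.
have idem j s x : hom_comp (i' j) (p' j) s (hom_comp (i' j) (p' j) s x) =
    hom_comp (i' j) (p' j) s x by rewrite !hom_compE pi'.
(* If one projector is the identity, the other summands vanish on both sides and [M] is [Mj j0].
   Otherwise all projectors are zero, and so is [M]. *)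
have [[j0 id_j0]|no_id] := pselect (exists j, forall s x, i' j s (p' j s x) = x).
  have Mj0 j : j != j0 -> pm_is_zero (Mj j).
    move=> jj0; apply: MjZ => s x; rewrite -[x]pi' -(id_j0 s (i' j s x)).
    by rewrite pi0' // eq_sym.
  apply: (iso_indecomposable_or_zero _ (Mj_ind j0)).
  apply: (pm_isoI (f := p j0) (g := i j0)) => s x; last exact: pi.
  apply/esym/eqP; rewrite -subr_eq0; apply/eqP/p0 => j.
  have [->|jj0] := eqVneq j j0; last exact: Mj0.
  by rewrite linearB /= pi subrr.
right=> s x; apply: p0 => j; apply: MjZ => {}s {}x.
have [e_0|e_1] := Nid _ (idem j); last first.
  by exfalso; apply: no_id; exists j => {}s {}x; rewrite -hom_compE.
by have := e_0 s (i' j s x); rewrite hom_compE pi' => ix; rewrite -[x]pi' ix linear0.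
Qed.

End Stability.

(** * Morphisms and interleavings defined on generators *)

Section PresentedMaps.
Variables (k : fieldType) (R : realType) (n : nat).

Section Map.
Variables (T U T' U' : finType).
Variables (a : T -> Rn R n) (b : U -> Rn R n) (X : U -> {ffun T -> k^o}).
Variables (M : pmod k R n) (q : forall s, 'Hom({ffun T -> k^o}, M s)).
Hypothesis X_gens : forall u, X u \in gens k a (b u).
Hypothesis sqM : subquot (gens k a) (rels b X) q.
Variables (a' : T' -> Rn R n) (b' : U' -> Rn R n) (X' : U' -> {ffun T' -> k^o}).
Variables (N : pmod k R n) (q' : forall s, 'Hom({ffun T' -> k^o}, N s)).
Hypothesis sqN : subquot (gens k a') (rels b' X') q'.
Variables (L : 'Hom({ffun T -> k^o}, {ffun T' -> k^o})) (e : R).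
Hypothesis L_gens : forall t, L (basis_vec k t) \in gens k a' (pshift (a t) e).
Hypothesis L_rels : forall u, L (X u) \in rels b' X' (pshift (b u) e).

Lemma map_gens s v : v \in gens k a s -> L v \in gens k a' (pshift s e).
Proof.
move=> /gensP vs; rewrite lfun_basis; apply: rpred_sum => t _.
have [->|/vs ts] := eqVneq (v t) 0; first by rewrite scale0r rpred0.
by apply: rpredZ; apply: (subvP (gens_mono k a' (pshift_le e ts))).
Qed.

Lemma map_rels s v : v \in rels b X s -> L v \in rels b' X' (pshift s e).
Proof.
rewrite memv_preim; move: v; apply/subvP; apply: rels_ind => u us.
by rewrite -memv_preim; apply: (subvP (rels_mono b' X' (pshift_le e us))).
Qed.

Lemma map_hom : exists f : pmhom M (pm_shift N e),
  forall s v, v \in gens k a s -> f s (q s v) = q' (pshift s e) (L v).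
Proof.
have [f fE] : exists f : pmhom M (pm_shift N e), forall s v, v \in gens k a s ->
    f s (q s v) = (q' (pshift s e) \o L)%VF v.
  apply: (sq_desc (gens_mono k a) sqM) => [s v vA vB|s t st v vA].
    by apply/eqP; rewrite comp_lfunE (sq_ker sqN) ?map_gens ?map_rels.
  by rewrite !comp_lfunE /= (sq_nat sqN) ?map_gens.
by exists f => s v vA; rewrite fE // comp_lfunE.
Qed.

End Map.

Section MapInterleaving.
Variables (T U T' U' : finType).
Variables (a : T -> Rn R n) (b : U -> Rn R n) (X : U -> {ffun T -> k^o}).
Variables (M : pmod k R n) (q : forall s, 'Hom({ffun T -> k^o}, M s)).
Hypothesis sqM : subquot (gens k a) (rels b X) q.
Variables (a' : T' -> Rn R n) (b' : U' -> Rn R n) (X' : U' -> {ffun T' -> k^o}).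
Variables (N : pmod k R n) (q' : forall s, 'Hom({ffun T' -> k^o}, N s)).
Hypothesis sqN : subquot (gens k a') (rels b' X') q'.
Variables (F : 'Hom({ffun T -> k^o}, {ffun T' -> k^o})).
Variables (G : 'Hom({ffun T' -> k^o}, {ffun T -> k^o})) (e : R).

Lemma map_inverse s (h : s <=p pshift (pshift s e) e) v :
  (forall t, F (basis_vec k t) \in gens k a' (pshift (a t) e)) ->
  (forall t, G (basis_vec k t) \in gens k a (pshift (a' t) e)) ->
  (forall t, G (F (basis_vec k t)) - basis_vec k t \in
     rels b X (pshift (pshift (a t) e) e)) ->
  v \in gens k a s ->
  q (pshift (pshift s e) e) (G (F v)) = pm_map M h (q s v).
Proof.
move=> Fg Gg GF vA; rewrite (sq_nat sqM) //; apply/eqP; rewrite -subr_eq0 -linearB.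
have vA2 : v \in gens k a (pshift (pshift s e) e) by apply: (subvP (gens_mono k a h)).
rewrite (sq_ker sqM); last by apply: rpredB => //; apply/(map_gens Gg)/(map_gens Fg).
have -> : G (F v) - v = (G \o F - \1)%VF v.
  by rewrite add_lfunE opp_lfunE comp_lfunE id_lfunE.
move/gensP: vA => vs; rewrite lfun_basis; apply: rpred_sum => t _.
rewrite add_lfunE opp_lfunE comp_lfunE id_lfunE.
have [->|/vs ts] := eqVneq (v t) 0; first by rewrite scale0r rpred0.
apply: rpredZ; apply: (subvP (rels_mono b X _) _ (GF t)).
by do 2!apply: pshift_le.
Qed.

End MapInterleaving.

Lemma map_interleaved (T U T' U' : finType)
    (a : T -> Rn R n) (b : U -> Rn R n) (X : U -> {ffun T -> k^o})
    (M : pmod k R n) (q : forall s, 'Hom({ffun T -> k^o}, M s))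
    (a' : T' -> Rn R n) (b' : U' -> Rn R n) (X' : U' -> {ffun T' -> k^o})
    (N : pmod k R n) (q' : forall s, 'Hom({ffun T' -> k^o}, N s))
    (F : 'Hom({ffun T -> k^o}, {ffun T' -> k^o}))
    (G : 'Hom({ffun T' -> k^o}, {ffun T -> k^o})) (e : R) :
  subquot (gens k a) (rels b X) q -> subquot (gens k a') (rels b' X') q' ->
  0 <= e ->
  (forall t, F (basis_vec k t) \in gens k a' (pshift (a t) e)) ->
  (forall u, F (X u) \in rels b' X' (pshift (b u) e)) ->
  (forall t, G (basis_vec k t) \in gens k a (pshift (a' t) e)) ->
  (forall u, G (X' u) \in rels b X (pshift (b' u) e)) ->
  (forall t, G (F (basis_vec k t)) - basis_vec k t \in
     rels b X (pshift (pshift (a t) e) e)) ->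
  (forall t, F (G (basis_vec k t)) - basis_vec k t \in
     rels b' X' (pshift (pshift (a' t) e) e)) ->
  interleaved e M N.
Proof.
move=> sqM sqN e0 Fg Fr Gg Gr GF FG; apply/interleavedP => //.
have [f fE] := map_hom sqM sqN Fg Fr; have [g gE] := map_hom sqN sqM Gg Gr.
exists f, g; split=> s h x.
  have [v vA <-] := sq_surj sqM x; rewrite fE // gE ?(map_gens Fg) //.
  exact: (map_inverse sqM h Fg Gg GF vA).
have [v vA <-] := sq_surj sqN x; rewrite gE // fE ?(map_gens Gg) //.
exact: (map_inverse sqN h Gg Fg FG vA).
Qed.

(** Reduces an endomorphism to a matrix on generators; the lift is determined only modulo
    relations. *)
Lemma lift_hom (T U : finType)
    (a : T -> Rn R n) (b : U -> Rn R n) (X : U -> {ffun T -> k^o})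
    (M : pmod k R n) (q : forall s, 'Hom({ffun T -> k^o}, M s)) (e : pmhom M M) :
  subquot (gens k a) (rels b X) q ->
  exists L : 'End({ffun T -> k^o}), forall s v, v \in gens k a s ->
    L v \in gens k a s /\ q s (L v) = e s (q s v).
Proof.
move=> sqM.
have exl t : exists v, v \in gens k a (a t) /\
    q (a t) v = e (a t) (q (a t) (basis_vec k t)).
  by have [v vA vE] := sq_surj sqM (e (a t) (q (a t) (basis_vec k t))); exists v.
have [l lE] := choice exl; exists (lincomb l) => s v /gensP vs.
split; rewrite lincombE.
  apply: rpred_sum => t _.
  have [->|/vs ts] := eqVneq (v t) 0; first by rewrite scale0r rpred0.
  by apply: rpredZ; apply: (subvP (gens_mono k a ts)); case: (lE t).
rewrite [in RHS](lfun_basis (q s)) !linear_sum; apply: eq_bigr => t _.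
rewrite !linearZ /=.
have [->|/vs ts] := eqVneq (v t) 0; first by rewrite !scale0r.
have [lt1 lt2] := lE t.
by rewrite -(sq_nat sqM ts lt1) lt2 hom_nat (sq_nat sqM ts) ?basis_gens.
Qed.

End PresentedMaps.

(** * A nearby module without nontrivial idempotents *)

(** Distinct values of [y] differ by more than a gap [g]. Adding distinct amounts smaller than [g]
    and [d] breaks ties without creating new ones. *)
Lemma injective_perturbation (R : realType) (T : finType) (y : T -> R) (d : R) :
  0 < d -> exists w : T -> R,
    injective w /\ (forall t, y t <= w t <= y t + d).
Proof.
move=> d0; have [g g0 gap] := pshift_gap (fun t (_ : 'I_1) => y t).
pose m := Num.min d g; have m0 : 0 < m by rewrite lt_min d0.
pose c : R := m / #|T|%:R.
pose r (t : T) : R := c * (enum_rank t)%:R.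
have r0 t : 0 <= r t by rewrite /r /c mulr_ge0 ?divr_ge0 ?(ltW m0).
have r_lt t : r t < m.
  have T0 : (0 < #|T|)%N by apply/card_gt0P; exists t.
  by rewrite /r /c mulrAC ltr_pdivrMr ?ltr0n // ltr_pM2l // ltr_nat ltn_ord.
have [md mg] : m <= d /\ m <= g by rewrite !ge_min !lexx orbT.
have lt_w s t : y s < y t -> y s + r s < y t + r t.
  move=> yst; have : y s + g < y t.
    rewrite ltNge; apply/negP => ytg; move: yst; rewrite ltNge => /negP; apply.
    by have /pleP/(_ ord0) := gap s t (introT (pleP _ _) (fun=> ytg)).
  have := r_lt s; have := r0 t; lra.
exists (fun t => y t + r t); split=> [s t /eqP wst|t]; last first.
  by have := r0 t; have := r_lt t; lra.
have [yst|yst|yst] := ltgtP (y s) (y t).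
- by rewrite lt_eqF ?lt_w in wst.
- by rewrite gt_eqF ?lt_w in wst.
have c0 : c != 0.
  rewrite mulf_neq0 ?invr_neq0 ?(gt_eqF m0) // pnatr_eq0 -lt0n.
  by apply/card_gt0P; exists s.
move: wst; rewrite yst (inj_eq (addrI _)) (inj_eq (mulfI c0)) eqr_nat => /eqP rst.
by apply: enum_rank_inj; apply: val_inj.
Qed.

Lemma norm_le_sum (R : realType) (T : finType) (x : T -> R) t :
  `|x t| <= \sum_s `|x s|.
Proof. by rewrite (bigD1 t) //= lerDl sumr_ge0. Qed.

(** [v] is an affine function of [w] with negative slope, so it reverses the order; the slope is so
    small that all values stay within [d] of a point far to the left of every [x t]. *)
Lemma far_antitone (R : realType) (T : finType) (x w : T -> R) (d : R) :
  0 < d -> exists (v : T -> R) (v0 : R),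
    [/\ forall t, v t <= v0 < v t + 3 * d, forall t, v0 < x t
      & forall s t, v s <= v t -> w t <= w s].
Proof.
move=> d0; pose W := \sum_t `|w t|; pose x0 := \sum_t `|x t|.
have W0 : 0 <= W by apply: sumr_ge0.
have W1 : 0 < 1 + W by lra.
pose h := d / (1 + W); have h0 : 0 < h by rewrite divr_gt0.
have hw t : `|h * w t| <= d.
  rewrite normrM gtr0_norm // /h mulrAC ler_pdivrMr // ler_pM2l //.
  by have := norm_le_sum w t; rewrite -/W; lra.
exists (fun t => - h * w t - x0 - 2 * d), (- x0 - d); split=> [t|t|s t].
- by have := hw t; rewrite ler_norml; lra.
- by have := norm_le_sum x t; rewrite -/x0 ler_norml; lra.
by rewrite !lerD2r !mulNr lerN2 ler_pM2l.
Qed.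

(** * The module with doubled generators and thin links *)

Section Density.
Variables (k : fieldType) (R : realType) (n : nat) (i0 i1 : 'I_n).
Hypothesis i01 : (i0 == i1) = false.
Variables (T U : finType).
Variables (a : T -> Rn R n) (b : U -> Rn R n) (X : U -> {ffun T -> k^o}).
Variables (M : pmod k R n) (q : forall s, 'Hom({ffun T -> k^o}, M s)).
Hypothesis X_gens : forall u, X u \in gens k a (b u).
Hypothesis sqM : subquot (gens k a) (rels b X) q.
Variable d : R.
Hypothesis d0 : 0 < d.
Variables (w v : T -> R) (v0 : R).
(* thin t has coordinates v t and w t + 3 * d at i0 and i1, and v0 is the
   coordinate at i0 of the relation hub.  By w_inj and v_anti, the degrees of the
   thin t form an antichain; by v_v0 and v0_x, hub comes before the death of any
   thin t and before any generator of M. *)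
Hypothesis w_inj : injective w.
Hypothesis w_y : forall t, a t i1 <= w t <= a t i1 + d.
Hypothesis v_v0 : forall t, v t <= v0 < v t + 3 * d.
Hypothesis v0_x : forall t, v0 < a t i0.
Hypothesis v_anti : forall s t, v s <= v t -> w t <= w s.

Variable z : Rn R n.
Hypothesis a_z : forall t i, a t i <= z i.

Let i10 : (i1 == i0) = false. Proof. by rewrite eq_sym. Qed.

Let T' : finType := ((T + T) + T)%type.
Let U' : finType := ((T + T) + (unit + U))%type.
Local Notation gen1 t := (inl (inl t) : T').
Local Notation gen2 t := (inl (inr t) : T').
Local Notation thin t := (inr t : T').
Local Notation link t := (inl (inl t) : U').
Local Notation death t := (inl (inr t) : U').
Local Notation hub := (inr (inl tt) : U').
Local Notation old u := (inr (inr u) : U').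

(** Delaying [gen1 t] along [i1] and [gen2 t] along [i0] makes them incomparable. The offset [3 * d]
    puts [thin t] above both along [i1], so it cannot occur in their images. *)
Let a' (t' : T') : Rn R n := fun i =>
  match t' with
  | inl (inl t) => if i == i1 then a t i1 + d else a t i
  | inl (inr t) => if i == i0 then a t i0 + d else a t i
  | inr t => if i == i0 then v t else if i == i1 then w t + 3 * d else a t i
  end.

(** [link t] lies just above its three generators. Along [i1], [hub] exceeds every link, and the
    delay [6 * d] keeps an old relation involving [s] out of the degree of [link t] unless [a s i1]
    is well below [a t i1]. *)
Let b' (u' : U') : Rn R n := fun i =>
  match u' with
  | inl (inl t) =>
    if i == i0 then a t i0 + d else if i == i1 then a t i1 + 4 * d else a t i
  | inl (inr t) => a' (thin t) i + 3 * d
  | inr (inl _) =>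
    if i == i0 then v0 else z i + 5 * d
  | inr (inr u) => b u i + 6 * d
  end.

Let X' (u' : U') : {ffun T' -> k^o} := [ffun t' =>
  match u', t' with
  | inl (inl t), inl (inl s) => (s == t)%:R
  | inl (inl t), inl (inr s) => - (s == t)%:R
  | inl (inl t), inr s => - (s == t)%:R
  | inl (inr t), inr s => (s == t)%:R
  | inr (inl _), inr _ => 1
  | inr (inr u), inl (inl s) => X u s
  | _, _ => 0
  end].

Let coordE := (eqxx, i01, i10).

Lemma tie_gens u' : X' u' \in gens k a' (b' u').
Proof.
have dp := d0; apply/gensP => t'; rewrite ffunE.
case: u' t' => [[t|t]|[[]|u]] [[s|s]|s] /=; rewrite ?eqxx //.
- have [->|//] := eqVneq s t; rewrite ?eqxx // => _; apply/pleP => i /=.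
  have [Ei|_] := eqVneq i i0; rewrite ?Ei ?coordE; first by lra.
  by have [Ei|_] := eqVneq i i1; rewrite ?Ei; lra.
- have [->|//] := eqVneq s t; rewrite ?oppr0 ?eqxx // => _; apply/pleP => i /=.
  have [Ei|_] := eqVneq i i0; rewrite ?Ei ?coordE; first by lra.
  by have [Ei|_] := eqVneq i i1; rewrite ?Ei; lra.
- have [->|//] := eqVneq s t; rewrite ?oppr0 ?eqxx // => _; apply/pleP => i /=.
  have := v_v0 t; have := v0_x t; have := w_y t.
  have [Ei|_] := eqVneq i i0; rewrite ?Ei ?coordE; first by lra.
  by have [Ei|_] := eqVneq i i1; rewrite ?Ei; lra.
- have [->|//] := eqVneq s t; rewrite ?eqxx // => _; apply/pleP => i /=.
  by lra.
- move=> _; apply/pleP => i /=; have := v_v0 s; have := w_y s; have := a_z s i.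
  have [Ei|_] := eqVneq i i0; rewrite ?Ei ?coordE; first by lra.
  by have [Ei|_] := eqVneq i i1; rewrite ?Ei; lra.
- move=> Xus; have /pleP as_ : a s <=p b u by move/gensP: (X_gens u); apply.
  apply/pleP => i /=; have := as_ i.
  by case: eqVneq => [Ei|_]; rewrite ?Ei; lra.
Qed.

Let T'E : ((forall s t, (gen1 s == gen1 t) = (s == t)) *
  (forall s t, (gen2 s == gen2 t) = (s == t)) *
  (forall s t, (thin s == thin t) = (s == t)))%type *
  ((forall s t, (gen1 s == gen2 t) = false) *
  (forall s t, (gen2 s == gen1 t) = false) *
  (forall s t, (gen1 s == thin t) = false) *
  (forall s t, (gen2 s == thin t) = false) *
  (forall s t, (thin s == gen1 t) = false) *
  (forall s t, (thin s == gen2 t) = false))%type.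
Proof. by []. Qed.

Let F := lincomb (fun t => basis_vec k (gen1 t)).

Let G := lincomb (fun t' : T' => match t' with
  | inl (inl t) | inl (inr t) => basis_vec k t
  | inr _ => 0
  end).

Let G1 t : G (basis_vec k (gen1 t)) = basis_vec k t.
Proof. exact: lincomb_basis. Qed.

Let G2 t : G (basis_vec k (gen2 t)) = basis_vec k t.
Proof. exact: lincomb_basis. Qed.

Let G3 t : G (basis_vec k (thin t)) = 0.
Proof. exact: lincomb_basis. Qed.

Let F1 t : F (basis_vec k t) = basis_vec k (gen1 t).
Proof. exact: lincomb_basis. Qed.

Let X'_link t : X' (link t) = basis_vec k (gen1 t) - basis_vec k (gen2 t)
  - basis_vec k (thin t).
Proof.
by apply/ffunP => -[[s|s]|s]; rewrite !ffunE !T'E /= ?subr0 ?sub0r ?subr0.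
Qed.

Let X'_death t : X' (death t) = basis_vec k (thin t).
Proof. by apply/ffunP => -[[s|s]|s]; rewrite !ffunE !T'E. Qed.

Let X'_hub : X' hub = \sum_t basis_vec k (thin t).
Proof.
apply/ffunP => t'; rewrite sum_ffunE ffunE; case: t' => [[s|s]|s].
- by rewrite big1 // => t _; rewrite ffunE.
- by rewrite big1 // => t _; rewrite ffunE.
rewrite (bigD1 s) //= ffunE eqxx big1 ?addr0 // => t ts.
by rewrite ffunE T'E eq_sym (negPf ts).
Qed.

Let X'_old u : X' (old u) = F (X u).
Proof.
apply/ffunP => t'; rewrite lincombE sum_ffunE ffunE; case: t' => [[s|s]|s].
- rewrite (bigD1 s) //= !ffunE eqxx big1 ?addr0 => [|t ts].
    by rewrite [_ *: _]mulr1.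
  by rewrite !ffunE T'E eq_sym (negPf ts) scaler0.
- by rewrite big1 // => t _; rewrite !ffunE scaler0.
- by rewrite big1 // => t _; rewrite !ffunE scaler0.
Qed.

Variables (N : pmod k R n) (q' : forall s, 'Hom({ffun T' -> k^o}, N s)).
Hypothesis sqN : subquot (gens k a') (rels b' X') q'.

(** [F] includes [M] by the first copies; [G] merges the two copies and kills the thin generators.
    The composites agree with the structure maps because [link t] and [death t] together identify
    [gen1 t] with [gen2 t]. *)
Lemma tie_interleaved : interleaved (6 * d) M N.
Proof.
have dp := d0.
apply: (map_interleaved (F := F) (G := G) sqM sqN) => [|t|u|[[t|t]|t]|[[t|t]|[[]|u]]|t|[[t|t]|t]].
- by lra.
- rewrite F1 basis_gens; apply/pleP => i; rewrite /pshift /=.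
  by case: ifP => [/eqP Ei|_]; rewrite ?Ei; lra.
- by rewrite -X'_old; apply: rels_basis.
- rewrite G1 basis_gens; apply/pleP => i; rewrite /pshift /=.
  by case: ifP => [/eqP Ei|_]; rewrite ?Ei; lra.
- rewrite G2 basis_gens; apply/pleP => i; rewrite /pshift /=.
  by case: ifP => [/eqP Ei|_]; rewrite ?Ei; lra.
- by rewrite G3 rpred0.
- by rewrite X'_link !linearB /= G1 G2 G3 subrr subr0 rpred0.
- by rewrite X'_death G3 rpred0.
- by rewrite X'_hub linear_sum big1 ?rpred0 // => t _; apply: G3.
- have -> : G (X' (old u)) = X u.
    rewrite X'_old {1}[X u]sum_basis !linear_sum [RHS]sum_basis.
    by apply: eq_bigr => t _; rewrite !linearZ /= F1 G1.
  by apply: rels_basis; apply/pleP => i; rewrite /pshift /=; lra.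
- by rewrite F1 G1 subrr rpred0.
- by rewrite G1 F1 subrr rpred0.
- rewrite G2 F1.
  have -> : basis_vec k (gen1 t) - basis_vec k (gen2 t) =
      X' (link t) + X' (death t) by rewrite X'_link X'_death subrK.
  apply: rpredD; apply: rels_basis; apply/pleP => i; rewrite /pshift /=.
    have [Ei|_] := eqVneq i i0; rewrite ?Ei ?coordE; first by lra.
    by have [Ei|_] := eqVneq i i1; rewrite ?Ei; lra.
  have := v_v0 t; have := w_y t; have := v0_x t.
  have [Ei|_] := eqVneq i i0; rewrite ?Ei ?coordE; first by lra.
  by have [Ei|_] := eqVneq i i1; rewrite ?Ei; lra.
rewrite G3 linear0 sub0r rpredN -X'_death; apply: rels_basis.
by apply/pleP => i; rewrite /pshift /=; lra.
Qed.

(** A linear functional vanishing on every relation present at [s] vanishes on their span; only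
    functionals in at most two coordinates are needed below. *)
Let kill (x y : T') (c : k) s (p : {ffun T' -> k^o}) :
  (forall u', b' u' <=p s -> X' u' x + c * X' u' y = 0) ->
  p \in rels b' X' s -> p x + c * p y = 0.
Proof.
have [f fE] : {f : 'Hom({ffun T' -> k^o}, k^o) | f =1 fun p => p x + c * p y}.
  apply: lfun_of => l p1 p2; rewrite !ffunE.
  change (l * p1 x + p2 x + c * (l * p1 y + p2 y) =
    l * (p1 x + c * p1 y) + (p2 x + c * p2 y)).
  by ring.
move=> Xxy pr; rewrite -fE; apply/eqP; rewrite -memv_ker; move: p pr.
by apply/subvP; apply: rels_ind => u us; rewrite memv_ker fE Xxy.
Qed.

Let not_le (s t : Rn R n) i : t i < s i -> ~ (s <=p t).
Proof. by move=> ts /pleP/(_ i); rewrite leNgt ts. Qed.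

(** The copies start to the right of [v0], and the thin degrees form an antichain. Hence a lifted
    endomorphism scales [thin t]. *)
Let thin_min t' t : a' t' <=p a' (thin t) -> t' = thin t.
Proof.
have dp := d0; have := v_v0 t; case: t' => [[s|s]|s] vt st.
- by exfalso; apply: (not_le (i := i0) _ st); rewrite /= !coordE; have := v0_x s; lra.
- by exfalso; apply: (not_le (i := i0) _ st); rewrite /= !coordE; have := v0_x s; lra.
have /pleP sti := st; have := sti i0; have := sti i1; rewrite /= !coordE => wst vst.
by congr (inr _); apply: w_inj; have := v_anti vst; lra.
Qed.

(** At the degree of [thin t], links and deaths are still absent along [i0], and [hub] along [i1].
    So [thin t] is nonzero in [N] and its coefficient is well defined. *)
Let thin_kill t p : p \in rels b' X' (a' (thin t)) -> p (thin t) = 0.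
Proof.
have dp := d0; have vt := v_v0 t.
move=> /(@kill (thin t) (thin t) 0); rewrite mul0r addr0; apply=> u' us.
rewrite mul0r addr0 ffunE; case: u' us => [[s|s]|[[]|u]] //= us; exfalso.
- by apply: (not_le (i := i0) _ us); rewrite /= !coordE; have := v0_x s; lra.
- by apply: (not_le (i := i0) _ us); rewrite /= !coordE; have := v_v0 s; lra.
apply: (not_le (i := i1) _ us); rewrite /= !coordE.
by have := w_y t; have := a_z t i1; lra.
Qed.

(** Links and deaths come later along [i0], and old relations do not involve thin generators; [hub]
    itself has equal thin coordinates. *)
Let hub_kill s t p : p \in rels b' X' (b' hub) -> p (thin s) = p (thin t).
Proof.
have dp := d0.
move=> /(@kill (thin s) (thin t) (-1)) ps; apply/eqP.
rewrite -subr_eq0 -mulN1r ps // => u' us; rewrite !ffunE.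
case: u' us => [[r|r]|[[]|u]] /= us; rewrite ?mulN1r ?subrr ?mulr1 //; exfalso.
- by apply: (not_le (i := i0) _ us); rewrite /= !coordE; have := v0_x r; lra.
- by apply: (not_le (i := i0) _ us); rewrite /= !coordE; have := v_v0 r; lra.
Qed.

(* The bound on the coordinates i1 excludes every relation involving gen1 s or
   thin s, except link s. *)
Let link_kill1 s t p : a t i1 - d <= a s i1 -> p \in rels b' X' (b' (link t)) ->
  p (gen1 s) + p (thin s) = 0.
Proof.
have dp := d0; move=> st /(@kill (gen1 s) (thin s) 1).
rewrite mul1r; apply=> u' us; rewrite mul1r !ffunE.
case: u' us => [[r|r]|[[]|u]] /= us; rewrite ?subrr ?addr0 ?add0r //.
- have [sr|//] := eqVneq s r; exfalso; move: us; rewrite -sr => us.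
  apply: (not_le (i := i1) _ us); rewrite /= !coordE; have := w_y s; lra.
- exfalso; apply: (not_le (i := i1) _ us); rewrite /= !coordE.
  by have := a_z t i1; lra.
apply: contrapT => /eqP Xus; apply: (not_le (i := i1) _ us); rewrite /= !coordE.
have /gensP/(_ s Xus)/pleP/(_ i1) := X_gens u; lra.
Qed.

Let link_kill2 s t p : a t i1 - d <= a s i1 -> p \in rels b' X' (b' (link t)) ->
  p (gen2 s) - p (thin s) = 0.
Proof.
have dp := d0; move=> st /(@kill (gen2 s) (thin s) (-1)).
rewrite mulN1r; apply=> u' us; rewrite mulN1r !ffunE.
case: u' us => [[r|r]|[[]|u]] /= us; rewrite ?subrr ?oppr0 ?addr0 ?add0r //.
- have [sr|] := eqVneq s r; last by rewrite oppr0.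
  exfalso; move: us; rewrite -sr => us.
  apply: (not_le (i := i1) _ us); rewrite /= !coordE; have := w_y s; lra.
- exfalso; apply: (not_le (i := i1) _ us); rewrite /= !coordE.
  by have := a_z t i1; lra.
Qed.

Let basis_in t' : basis_vec k t' \in gens k a' (a' t').
Proof. by rewrite basis_gens. Qed.

Let lift_thin (e : pmhom N N) (L : 'End({ffun T' -> k^o})) t :
  (forall s p, p \in gens k a' s -> L p \in gens k a' s /\ q' s (L p) = e s (q' s p)) ->
  L (basis_vec k (thin t)) = L (basis_vec k (thin t)) (thin t) *: basis_vec k (thin t).
Proof.
move=> LP; have [/gensP Lg _] := LP _ _ (basis_in (thin t)).
apply/ffunP => t'; rewrite !ffunE; have [->|tt'] := eqVneq t' (thin t).
  by rewrite [_ *: _]mulr1.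
by rewrite scaler0; apply: contraNeq tt' => /Lg /thin_min ->.
Qed.

Let lift_rels (e : pmhom N N) (L : 'End({ffun T' -> k^o})) s p :
  (forall s p, p \in gens k a' s -> L p \in gens k a' s /\ q' s (L p) = e s (q' s p)) ->
  p \in rels b' X' s -> L p \in rels b' X' s.
Proof.
move=> LP pr; have pg := subvP (rels_sub tie_gens s) _ pr.
have [Lg Lq] := LP _ _ pg; rewrite -(sq_ker sqN Lg) Lq.
by move: pr; rewrite -(sq_ker sqN pg) => /eqP ->; rewrite linear0.
Qed.

(* The lift of e is strictly triangular for the order of the degrees. *)
Let tie_nilpotent (e : pmhom N N) : (forall s x, e s (e s x) = e s x) ->
  (forall t, e _ (q' (a' (thin t)) (basis_vec k (thin t))) = 0) ->
  forall s x, e s x = 0.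
Proof.
have dp := d0; move=> ee e_thin; have [L LP] := lift_hom e sqN.
have Lthin t : L (basis_vec k (thin t)) = 0.
  have [Lg Lq] := LP _ _ (basis_in (thin t)).
  rewrite (lift_thin t LP) (@thin_kill t _ _) ?scale0r //.
  by rewrite -(sq_ker sqN Lg) Lq e_thin.
have Lle t' t'' : L (basis_vec k t') t'' != 0 -> a' t'' <=p a' t'.
  by have [/gensP Lg _] := LP _ _ (basis_in t'); apply: Lg.
(* As [L] kills [thin t], this difference is the image of the relation [link t]. *)
have Llink t : L (basis_vec k (gen1 t)) - L (basis_vec k (gen2 t)) \in
    rels b' X' (b' (link t)).
  rewrite -linearB -[_ - _](subrK (basis_vec k (thin t))) -X'_link linearD /= Lthin.
  by rewrite addr0; apply: (lift_rels LP); apply: rels_basis.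
(* The bound with [- d] is the weakest consequence along [i1] of a copy of [t] lying below a copy of
   [s]; it comes from [gen2 t] below [gen1 s]. *)
have Lthin1 s t : a t i1 - d <= a s i1 -> L (basis_vec k (gen1 t)) (thin s) = 0.
  move=> st; apply: contrapT => /eqP /Lle le.
  by apply: (not_le (i := i1) _ le); rewrite /= !coordE; have := w_y s; lra.
have Lthin2 s t : a t i1 - d <= a s i1 -> L (basis_vec k (gen2 t)) (thin s) = 0.
  move=> st; apply: contrapT => /eqP /Lle le.
  by apply: (not_le (i := i1) _ le); rewrite /= !coordE; have := w_y s; lra.
have L12_1 s t : a t i1 - d <= a s i1 ->
    L (basis_vec k (gen1 t)) (gen1 s) = L (basis_vec k (gen2 t)) (gen1 s).
  move=> st; have := link_kill1 st (Llink t).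
  by rewrite !ffunE Lthin1 // Lthin2 // subrr addr0 => /eqP; rewrite subr_eq0 => /eqP.
have L12_2 s t : a t i1 - d <= a s i1 ->
    L (basis_vec k (gen1 t)) (gen2 s) = L (basis_vec k (gen2 t)) (gen2 s).
  move=> st; have := link_kill2 st (Llink t).
  by rewrite !ffunE Lthin1 // Lthin2 // subrr subr0 => /eqP; rewrite subr_eq0 => /eqP.
have n12 t : ~ (a' (gen1 t) <=p a' (gen2 t)).
  by apply: (not_le (i := i1)); rewrite /= !coordE; lra.
have n21 t : ~ (a' (gen2 t) <=p a' (gen1 t)).
  by apply: (not_le (i := i0)); rewrite /= !coordE; lra.
(* Suppose [t''] occurs in the image of one copy of [t] and lies above that copy. By [L12_1] and
   [L12_2] it occurs in the image of the other copy too, so it lies below that one, and the two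
   copies would be comparable. *)
have strict t' t'' : L (basis_vec k t') t'' != 0 -> ~ (a' t' <=p a' t'').
  case: t' => [[t|t]|t]; last by rewrite Lthin ffunE eqxx.
    case: t'' => [[s|s]|s] nz le; last by have := thin_min le.
      have /pleP/(_ i1) := le; rewrite /= !coordE => st.
      by apply: (n12 t); apply: le_trans le _; apply: Lle; rewrite -L12_1 //; lra.
    have /pleP/(_ i1) := le; rewrite /= !coordE => st.
    by apply: (n12 t); apply: le_trans le _; apply: Lle; rewrite -L12_2 //; lra.
  case: t'' => [[s|s]|s] nz le; last by have := thin_min le.
    have /pleP/(_ i1) := le; rewrite /= !coordE => st.
    by apply: (n21 t); apply: le_trans le _; apply: Lle; rewrite L12_1 //; lra.
  have /pleP/(_ i1) := le; rewrite /= !coordE => st.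
  by apply: (n21 t); apply: le_trans le _; apply: Lle; rewrite L12_2 //; lra.
(* Induction on the number of generators below [t']: idempotence rewrites the value as [e] applied
   to a combination of strictly smaller generators. *)
have e0 t' : e (a' t') (q' (a' t') (basis_vec k t')) = 0.
  have [m] := ubnP #|[set t'' | a' t'' <=p a' t']%SET|.
  elim: m t' => // m IH t'; rewrite ltnS => t'm.
  have [_ Lq] := LP _ _ (basis_in t').
  rewrite -ee -Lq (lfun_basis (q' _)) linear_sum big1 // => t'' _; rewrite linearZ /=.
  have [->|nz] := eqVneq (L (basis_vec k t') t'') 0; first by rewrite scale0r.
  have le := Lle _ _ nz; rewrite -(sq_nat sqN le) // -hom_nat IH ?linear0 ?scaler0 //.
  apply: leq_trans t'm; apply: proper_card; apply/properP; split.
    by apply/fintype.subsetP => r; rewrite !inE => rt; apply: le_trans rt le.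
  exists t'; rewrite !inE //.
  by apply/negP => le'; apply: (strict _ _ nz).
move=> s x; rewrite -(hom0E N x); apply: (pres_ext sqN) => t'.
by rewrite e0 hom0E.
Qed.

(** The scalar on the thin generators decides: 0 makes [e] vanish by [tie_nilpotent], and 1 makes
    its complement vanish. *)
Lemma tie_idem (e : pmhom N N) : (forall s x, e s (e s x) = e s x) ->
  (forall s x, e s x = 0) \/ (forall s x, e s x = x).
Proof.
move=> ee; have [L LP] := lift_hom e sqN.
have [t0|T0] := pickP (fun _ : T => true); last first.
  by left; apply: tie_nilpotent => // t; have := T0 t.
pose c := L (basis_vec k (thin t0)) (thin t0).
have Lc t : L (basis_vec k (thin t)) = c *: basis_vec k (thin t).
  rewrite (lift_thin t LP); congr (_ *: _).
  (* The image of [hub] is a relation at the degree of [hub], so its thin coordinates, which are the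
     scalars, coincide. *)
  have : L (X' hub) \in rels b' X' (b' hub) by apply/(lift_rels LP)/rels_basis.
  have -> : L (X' hub) = \sum_s L (basis_vec k (thin s)) (thin s) *: basis_vec k (thin s).
    by rewrite X'_hub linear_sum; apply: eq_bigr => s _; rewrite -(lift_thin s LP).
  have ev s : (\sum_r L (basis_vec k (thin r)) (thin r) *: basis_vec k (thin r))
      (thin s) = L (basis_vec k (thin s)) (thin s).
    rewrite sum_ffunE (bigD1 s) //= !ffunE eqxx [_ *: _]mulr1 big1 ?addr0 // => r rs.
    by rewrite !ffunE T'E eq_sym (negPf rs) scaler0.
  by move=> /(hub_kill t t0); rewrite !ev.
have e_thin t : e _ (q' (a' (thin t)) (basis_vec k (thin t))) =
    c *: q' (a' (thin t)) (basis_vec k (thin t)).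
  by have [_ <-] := LP _ _ (basis_in (thin t)); rewrite Lc linearZ.
(* Idempotence of [e] passes to the scalar because [thin t0] does not vanish in [N]. *)
have cc : c * c = c.
  apply/eqP; rewrite -subr_eq0; apply/eqP.
  have : (c * c - c) *: basis_vec k (thin t0) \in rels b' X' (a' (thin t0)).
    rewrite -(sq_ker sqN) ?rpredZ // linearZ /= scalerBl -scalerA -!e_thin.
    by rewrite -linearZ /= -e_thin ee subrr.
  by move=> /thin_kill; rewrite !ffunE eqxx [_ *: _]mulr1.
have [c0|cn0] := eqVneq c 0.
  by left; apply: tie_nilpotent => // t; rewrite e_thin c0 scale0r.
have c1 : c = 1 by apply: (mulfI cn0); rewrite cc mulr1.
right=> s x; apply/esym/eqP; rewrite -subr_eq0 -hom_complE; apply/eqP.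
apply: tie_nilpotent => [{}s {}x|t].
  by rewrite !hom_complE linearB /= ee subrr subr0.
by rewrite hom_complE e_thin c1 scale1r subrr.
Qed.

End Density.

Lemma close_to_idem_trivial (k : fieldType) (R : realType) (n : nat)
    (M : pmod k R n) (d : R) :
  (2 <= n)%N -> fin_presentable M -> 0 < d ->
  exists N : pmod k R n, [/\ fin_presentable N, interleaved d M N &
    forall e : pmhom N N, (forall s x, e s (e s x) = e s x) ->
      (forall s x, e s x = 0) \/ (forall s x, e s x = x)].
Proof.
move=> n2 /pres_of_fp[T [U [a [b [X [q [Xg sqM]]]]]]] d_gt0.
pose i0 : 'I_n := Ordinal (ltnW n2); pose i1 : 'I_n := Ordinal n2.
have i01 : (i0 == i1) = false by [].
(* [tie_interleaved] loses a factor 6. *)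
pose c := d / 6; have c0 : 0 < c by rewrite divr_gt0.
have [w [w_inj w_y]] := injective_perturbation (fun t => a t i1) c0.
have [v [v0 [v_v0 v0_x v_anti]]] := far_antitone (fun t => a t i0) w c0.
have a_z t i : a t i <= \sum_s `|a s i|.
  exact: le_trans (ler_norm _) (norm_le_sum (fun s => a s i) t).
have [N [q' sqN]] := sq_ex (gens_mono k _) (rels_mono _ _)
  (rels_sub (tie_gens i01 Xg c0 w_y v_v0 v0_x a_z)).
exists N; split.
- exact: fp_of_pres (tie_gens i01 Xg c0 w_y v_v0 v0_x a_z) sqN.
- have -> : d = 6 * c by rewrite /c mulrC divfK.
  exact: (tie_interleaved sqM c0 w_y v_v0 v0_x sqN).
by move=> e; apply: (tie_idem i01 Xg c0 w_inj w_y v_v0 v0_x v_anti a_z sqN).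
Qed.

Theorem corollary1p2 (k : fieldType) (R : realType) (n : nat) (hn : (2 <= n)%N)
    (M : pmod k R n) (hM : fin_presentable M) :
  structurally_stable M <-> indecomposable M \/ pm_is_zero M.
Proof.
split=> [Mst|Mind].
  apply: indecomposable_or_zero_of_close => // d d0.
  exact: close_to_idem_trivial.
apply: stable_of_not_decomposable => //.
by case: Mind => [[]|/zero_not_decomposable].
Qed.
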